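(* Let $n\ge 2$ and let $P$ be a simple weight $D_n$-module. The following statements about $S_n$-modules (for the given $n$) hold, where subquotients are considered up to isomorphism. (a) If $n\ge 3$, $P\not\cong A_n$ and $P\not\cong A_n^F$ (as $D_n$-modules), the nontrivial irreducible subquotients of $F(P,V(\delta_1))$ are $F(P,V(\delta_0))=P$ and $L_n(P,2)$. (b) If $n\ge 3$, the nontrivial irreducible subquotients of $F(A_n,V(\delta_1))$ are $A_n/\mathbb{C}t^0$ and $L_n(A_n,2)$. (c) If $n\ge 3$, the nontrivial irreducible subquotients of $F(A_n^F,V(\delta_1))$ are $\Delta A_n^F$ and $L_n(A_n^F,2)$. (d) If $n=2$, $P\not\cong A_2$ and $P\not\cong A_2^F$, then $F(P,V(\delta_1))$ has a unique nontrivial irreducible subquotient, namely $F(P,V(\delta_0))=P$. (e) For $n=2$, $F(A_2,V(\delta_1))$ has a unique nontrivial irreducible subquotient, namely $A_2/\mathbb{C}t^0$. (f) For $n=2$, $F(A_2^F,V(\delta_1))$ has a unique nontrivial irreducible subquotient, namely $\Delta A_2^F$.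
   Context: Everything is over $\mathbb{C}$. $A_n=\mathbb{C}[t_1,\dots,t_n]$, $\partial_i=\partial/\partial t_i$, and $D_n$ is the Weyl algebra generated by $t_i,\partial_i$ ($1\le i\le n$) with $[t_i,t_j]=[\partial_i,\partial_j]=0$, $[\partial_i,t_j]=\delta_{ij}$; $A_n$ is a $D_n$-module in the natural way. A $D_n$-module is a weight module if $t_1\partial_1,\dots,t_n\partial_n$ act simultaneously diagonalizably. $S_n=\{\sum_i p_i\partial_i : p_i\in A_n,\ \sum_i\partial_i(p_i)=0\}$ is the Lie algebra of divergence zero vector fields. A module over a Lie algebra is trivial if the Lie algebra acts by zero. $t^0=1\in A_n$. $F$ (as a superscript) is the automorphism of $D_n$ with $F(t_i)=\partial_i$, $F(\partial_i)=-t_i$, and $A_n^F$ is the $D_n$-module with underlying space $A_n$ and action $x\cdot p=F(x)p$. $E_{ij}$ are the $n\times n$ matrix units, $\varepsilon_1,\dots,\varepsilon_n$ is the standard basis of $\mathbb{C}^n$, and $V(\delta_r)=\bigwedge^r\mathbb{C}^n$ ($0\le r\le n$) as an $\mathfrak{sl}_n$-module. For a $D_n$-module $P$ and an $\mathfrak{sl}_n$-module $M$, the Shen-Larsson module $F(P,M)$ is $P\otimes_{\mathbb C}M$ with the $S_n$-action $$X\cdot(p\otimes v)=\sum_i(p_i\partial_i p)\otimes v+\sum_{s,i=1}^n(\partial_s(p_i)p)\otimes E_{si}v,\qquad X=\sum_i p_i\partial_i\in S_n$$ (well defined since $\sum_{s,i}\partial_s(p_i)\otimes E_{si}\in A_n\otimes\mathfrak{sl}_n$).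 In particular $F(P,V(\delta_0))=P$ with $S_n\subset D_n$ acting naturally. $\Delta P:=\sum_{i=1}^n\partial_iP$, an $S_n$-submodule of $P$. For $1\le r\le n$, $L_n(P,r)$ is the image of the $S_n$-homomorphism $\pi_{r-1}:F(P,V(\delta_{r-1}))\to F(P,V(\delta_r))$, $\pi_{r-1}(p\otimes v)=\sum_{l=1}^n\partial_lp\otimes(\varepsilon_l\wedge v)$. *)

(* Defs.v *)
From HB Require Import structures.
From mathcomp Require Import all_boot all_order all_algebra.
From mathcomp Require Import boolp reals ssrcomplements mpoly complex.

Set Implicit Arguments.
Unset Strict Implicit.
Unset Printing Implicit Defensive.

Import GRing.Theory.
Local Open Scope ring_scope.
Local Open Scope quotient_scope.

(* A module over the Weyl algebra D_n is given through the presentation of    *)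
(* D_n: a K-vector space with operators t_i (wt) and d_i (wd) that satisfy    *)
(* the defining relations.                                                    *)
Record weyl_module (K : fieldType) (n : nat) := WeylModule {
  wm_space :> lmodType K;
  wt : 'I_n -> {linear wm_space -> wm_space};
  wd : 'I_n -> {linear wm_space -> wm_space};
  wtC : forall i j v, wt i (wt j v) = wt j (wt i v);
  wdC : forall i j v, wd i (wd j v) = wd j (wd i v);
  wdt : forall i j v, wd i (wt j v) - wt j (wd i v) = (i == j)%:R *: v }.

Arguments wt {K n} w i.
Arguments wd {K n} w i.

Section WeylModules.
Variables (K : fieldType) (n : nat).
Implicit Types P Q : weyl_module K n.

Definition D_iso P Q := exists f : {linear P -> Q},
  [/\ bijective f, forall i v, f (wt P i v) = wt Q i (f v)
    & forall i v, f (wd P i v) = wd Q i (f v)].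

Definition D_submodule P (N : P -> Prop) :=
  [/\ N 0, forall (a : K) u v, N u -> N v -> N (a *: u + v),
      forall i v, N v -> N (wt P i v) & forall i v, N v -> N (wd P i v)].

Definition D_simple P :=
  (exists v : P, v <> 0) /\
  forall N : P -> Prop, D_submodule N ->
    (forall v, N v -> v = 0) \/ (forall v, N v).

Definition weight_vector P (v : P) :=
  forall i, exists a : K, wt P i (wd P i v) = a *: v.

(* P is spanned by common eigenvectors of the t_i d_i, that is, the latter    *)
(* act simultaneously diagonalizably.                                         *)
Definition D_weight P := forall v : P,
  exists s : seq P, (forall w, w \in s -> weight_vector w) /\ v = \sum_(w <- s) w.

Definition An_t (i : 'I_n) (p : {mpoly K[n]}) := 'X_i * p.

Fact An_t_is_linear i : linear (An_t i).
Proof. by move=> a p q; rewrite /An_t mulrDr scalerAr. Qed.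
HB.instance Definition _ i :=
  GRing.isLinear.Build K {mpoly K[n]} {mpoly K[n]} _ (An_t i) (An_t_is_linear i).

Fact An_tC i j p : An_t i (An_t j p) = An_t j (An_t i p).
Proof. by rewrite /An_t mulrCA. Qed.

Fact An_dC i j (p : {mpoly K[n]}) : mderiv i (mderiv j p) = mderiv j (mderiv i p).
Proof. exact: mderiv_comm. Qed.

Lemma mderiv_var (i j : 'I_n) : mderiv i ('X_j : {mpoly K[n]}) = (i == j)%:R.
Proof.
rewrite mderivX mnm1E eq_sym; case: eqVneq => [->|_]; last by rewrite scale0r.
by rewrite scale1r (_ : U_(j) - U_(j) = 0)%MM ?mpolyX0 //; apply/mnmP => k; rewrite mnmBE subnn mnm0E.
Qed.

Fact An_dt i j p :
  mderiv i (An_t j p) - An_t j (mderiv i p) = (i == j)%:R *: p :> {mpoly K[n]}.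
Proof.
by rewrite /An_t mderivM addrK mderiv_var scaler_nat mulr_natl.
Qed.

Definition An : weyl_module K n :=
  @WeylModule K n {mpoly K[n]} (fun i => An_t i) (fun i => @mderiv n K i) An_tC An_dC An_dt.

(* P^F: the module P twisted by the automorphism t_i |-> d_i, d_i |-> - t_i. *)
Definition opp_t P i (v : P) := - wt P i v.
Fact opp_t_is_linear P i : linear (@opp_t P i).
Proof. by move=> a u v; rewrite /opp_t linearP opprD scalerN. Qed.
HB.instance Definition _ P i :=
  GRing.isLinear.Build K P P _ (@opp_t P i) (@opp_t_is_linear P i).

Fact opp_tC P i j (v : P) : opp_t i (opp_t j v) = opp_t j (opp_t i v).
Proof. by rewrite /opp_t !linearN /= wtC. Qed.

Fact twist_dt P i j (v : P) :
  opp_t i (wd P j v) - wd P j (opp_t i v) = (i == j)%:R *: v.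
Proof. by rewrite /opp_t linearN opprK addrC wdt eq_sym. Qed.

Definition twistF P : weyl_module K n :=
  @WeylModule K n P (wd P) (fun i => @opp_t P i) (@wdC _ _ P) (@opp_tC P)
    (@twist_dt P).

End WeylModules.

Arguments An : clear implicits.

Section PolyAction.
Variables (K : fieldType) (n : nat).
Implicit Types (P : weyl_module K n) (p q : {mpoly K[n]}) (m : 'X_{1..n}).

Definition mon_act P m (v : P) : P :=
  foldr (fun i => iter (m i) (wt P i)) v (enum 'I_n).

Definition poly_act P p (v : P) : P :=
  \sum_(m <- msupp p) p@_m *: mon_act m v.

Lemma mon_act_is_linear P m : linear (@mon_act P m).
Proof.
move=> a u v; rewrite /mon_act; elim: (enum _) => //= i s ->.
by elim: (m i) => //= k ->; rewrite linearP.
Qed.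
HB.instance Definition _ P m :=
  GRing.isLinear.Build K P P _ (@mon_act P m) (@mon_act_is_linear P m).

Lemma poly_act_is_linear P p : linear (@poly_act P p).
Proof.
move=> a u v; rewrite /poly_act scaler_sumr -big_split; apply: eq_bigr => m _.
by rewrite linearP scalerDr !scalerA mulrC.
Qed.
HB.instance Definition _ P p :=
  GRing.isLinear.Build K P P _ (@poly_act P p) (@poly_act_is_linear P p).

Lemma poly_actwE P p k (v : P) : (msize p <= k)%N ->
  poly_act p v = \sum_(m : 'X_{1..n < k}) p@_m *: mon_act m v.
Proof.
move=> le_pk; rewrite /poly_act (big_mksub 'X_{1..n < k}) //=; first last.
- by move=> m /msize_mdeg_lt lt_mp; exact: leq_trans lt_mp le_pk.
- exact: msupp_uniq.
by rewrite big_rmcond //= => m /memN_msupp_eq0 ->; rewrite scale0r.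
Qed.

Lemma poly_actDZ P (a : K) p q (v : P) :
  poly_act (a *: p + q) v = a *: poly_act p v + poly_act q v.
Proof.
pose k := maxn (msize (a *: p + q)) (maxn (msize p) (msize q)).
rewrite !(@poly_actwE P _ k) ?leq_max ?leqnn ?orbT // scaler_sumr -big_split.
by apply: eq_bigr => m _; rewrite mcoeffD mcoeffZ scalerDl scalerA.
Qed.

Lemma poly_act0 P (v : P) : poly_act 0 v = 0.
Proof. by rewrite /poly_act msupp0 big_nil. Qed.
Lemma poly_actD P p q (v : P) : poly_act (p + q) v = poly_act p v + poly_act q v.
Proof. by have:= poly_actDZ 1 p q v; rewrite !scale1r. Qed.
Lemma poly_actZ P a p (v : P) : poly_act (a *: p) v = a *: poly_act p v.
Proof. by have:= poly_actDZ a p 0 v; rewrite poly_act0 !addr0. Qed.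
Lemma poly_actN P p (v : P) : poly_act (- p) v = - poly_act p v.
Proof. by have:= poly_actZ (-1) p v; rewrite !scaleN1r. Qed.
Lemma poly_actB P p q (v : P) : poly_act (p - q) v = poly_act p v - poly_act q v.
Proof. by rewrite poly_actD poly_actN. Qed.
Lemma poly_act_sum P I (r : seq I) (F : I -> {mpoly K[n]}) (v : P) :
  poly_act (\sum_(i <- r) F i) v = \sum_(i <- r) poly_act (F i) v.
Proof.
by elim: r => [|i r IH]; rewrite ?big_nil ?poly_act0 // !big_cons poly_actD IH.
Qed.

Lemma poly_actXm P m (v : P) : poly_act 'X_[m] v = mon_act m v.
Proof. by rewrite /poly_act msuppX big_seq1 mcoeffX eqxx scale1r. Qed.

Lemma mon_act0 P (v : P) : mon_act 0%MM v = v.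
Proof. by rewrite /mon_act; elim: (enum _) => //= i s ->; rewrite mnm0E. Qed.

Lemma iter_wtC P i j k l (v : P) :
  iter k (wt P i) (iter l (wt P j) v) = iter l (wt P j) (iter k (wt P i) v).
Proof.
elim: k => //= k ->; elim: l => //= l IH.
by rewrite -IH wtC.
Qed.

Lemma mon_actD P m1 m2 (v : P) :
  mon_act (m1 + m2)%MM v = mon_act m1 (mon_act m2 v).
Proof.
rewrite /mon_act; elim: (enum _) => //= i s ->; rewrite mnmDE iterD.
congr iter; move: (foldr _ v s) => w; elim: s => //= j s <-; exact: iter_wtC.
Qed.

Lemma poly_actM P p q (v : P) : poly_act (p * q) v = poly_act p (poly_act q v).
Proof.
elim/mpolyind: p => [|a m p _ _ IH]; first by rewrite mul0r !poly_act0.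
rewrite mulrDl !poly_actD IH -scalerAl !poly_actZ; congr (_ *: _ + _) => {p IH}.
elim/mpolyind: q => [|b m' q _ _ IH]; first by rewrite mulr0 !poly_act0 linear0.
rewrite mulrDr !poly_actD IH linearD -scalerAr !poly_actZ linearZ /=.
by rewrite -mpolyXD !poly_actXm mon_actD.
Qed.

Lemma poly_act1 P (v : P) : poly_act 1 v = v.
Proof. by rewrite -mpolyX0 poly_actXm mon_act0. Qed.

Lemma poly_actX P i (v : P) : poly_act 'X_i v = wt P i v.
Proof.
rewrite poly_actXm /mon_act.
have : i \in enum 'I_n by rewrite mem_enum.
have:= enum_uniq 'I_n; elim: (enum _) => //= j s IH /andP[jNs us].
rewrite inE mnm1E; case: eqVneq => [->|ne] /=.
  move=> _; congr (wt P j _); elim: s jNs {us IH} => //= k s IH.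
  by rewrite inE negb_or mnm1E => /andP[/negPf -> /IH ->].
exact: IH.
Qed.

Lemma poly_actC P p q (v : P) : poly_act p (poly_act q v) = poly_act q (poly_act p v).
Proof. by rewrite -!poly_actM mulrC. Qed.

Lemma wd_poly_act P i p (v : P) :
  wd P i (poly_act p v) = poly_act (mderiv i p) v + poly_act p (wd P i v).
Proof.
elim/mpolyind: p => [|a m p _ _ IH]; first by rewrite mderiv0 !poly_act0 linear0 addr0.
rewrite !poly_actD linearD IH mderivD poly_actD mderivZ !poly_actZ linearZ /=.
rewrite [RHS]addrACA; congr (_ + _); rewrite -scalerDr; congr (_ *: _) => {p IH}.
pose good p := forall v, wd P i (poly_act p v) =
  poly_act (mderiv i p) v + poly_act p (wd P i v).
have goodM p q : good p -> good q -> good (p * q).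
  move=> gp gq w; rewrite !poly_actM gp gq mderivM poly_actD !poly_actM linearD.
  by rewrite addrA.
have good1 : good 1.
  by move=> w; rewrite -mpolyC1 mderivC poly_act0 mpolyC1 !poly_act1 add0r.
apply: (_ : good _); rewrite mpolyXE_id; apply: big_ind => // j _.
elim: (m j) => [|k IH]; first by rewrite expr0.
rewrite exprS; apply: goodM => // w; rewrite !poly_actX mderiv_var.
have /(canRL (subrK _)) -> := wdt i j w.
by congr (_ + _); case: eqP; rewrite ?scale1r ?poly_act1 // scale0r poly_act0.
Qed.

End PolyAction.

(* The vector field \sum_i p_i d_i is represented by the family (p_i)_i.     *)
Section DivergenceFree.
Variables (K : fieldType) (n : nat).

Local Notation vfield := {ffun 'I_n -> {mpoly K[n]}}.

Definition divergence (X : vfield) := \sum_i mderiv i (X i).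

Definition vf_bracket (X Y : vfield) : vfield :=
  [ffun i => \sum_j (X j * mderiv j (Y i) - Y j * mderiv j (X i))].

Definition div_free : {pred vfield} := fun X => divergence X == 0.

Lemma div_freeE X : (X \in div_free) = (divergence X == 0).
Proof. by []. Qed.

Fact div_free_submod : submod_closed div_free.
Proof.
split=> [|a X Y]; rewrite !div_freeE /divergence.
  by apply/eqP; rewrite big1 // => i _; rewrite ffunE mderiv0.
move=> /eqP hX /eqP hY; apply/eqP.
transitivity (a *: divergence X + divergence Y); last first.
  by rewrite /divergence hX hY scaler0 addr0.
rewrite scaler_sumr -big_split; apply: eq_bigr => i _.
by rewrite !ffunE mderivD mderivZ.
Qed.
HB.instance Definition _ :=
  GRing.isSubmodClosed.Build K vfield div_free div_free_submod.

Record Sn := SnField { Sn_val :> vfield; Sn_valP : Sn_val \in div_free }.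
HB.instance Definition _ := [isSub for Sn_val].
HB.instance Definition _ := [Choice of Sn by <:].
HB.instance Definition _ := [SubChoice_isSubLmodule of Sn by <:].

Lemma Sn_div (X : Sn) : \sum_i mderiv i (X i) = 0.
Proof. exact/eqP/(Sn_valP X). Qed.

Fact vf_bracket_div_free (X Y : Sn) : vf_bracket X Y \in div_free.
Proof.
rewrite div_freeE /divergence; apply/eqP.
have -> : \sum_i mderiv i (vf_bracket X Y i) =
    \sum_j (X j * mderiv j (\sum_i mderiv i (Y i))
            - Y j * mderiv j (\sum_i mderiv i (X i))); last first.
  by rewrite !Sn_div big1 // => j _; rewrite !mderiv0 !mulr0 subr0.
under eq_bigr => i _.
  rewrite ffunE linear_sum /=.
  under eq_bigr => j _ do rewrite mderivB !mderivM opprD addrACA.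
  rewrite big_split /=.
  over.
rewrite big_split /= [X in X + _](_ : _ = 0) ?add0r; last first.
  under eq_bigr => i _ do rewrite sumrB.
  rewrite sumrB [X in _ - X]exchange_big /=; apply/eqP; rewrite subr_eq0.
  by apply/eqP; do 2!apply: eq_bigr => ? _; rewrite mulrC.
rewrite exchange_big; apply: eq_bigr => j _.
rewrite !linear_sum !mulr_sumr -sumrB; apply: eq_bigr => i _.
by rewrite (mderiv_comm j i) (mderiv_comm j i).
Qed.

Definition Sn_bracket (X Y : Sn) : Sn := SnField (vf_bracket_div_free X Y).

End DivergenceFree.

Record Sn_module (K : fieldType) (n : nat) := SnModule {
  Sn_space :> lmodType K;
  Sn_act : Sn K n -> Sn_space -> Sn_space;
  Sn_actDl : forall a X Y v, Sn_act (a *: X + Y) v = a *: Sn_act X v + Sn_act Y v;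
  Sn_actDr : forall X, linear (Sn_act X);
  Sn_actB : forall X Y v,
    Sn_act (Sn_bracket X Y) v = Sn_act X (Sn_act Y v) - Sn_act Y (Sn_act X v) }.

Arguments Sn_act {K n s} X v.

HB.instance Definition _ K n (M : Sn_module K n) (X : Sn K n) :=
  GRing.isLinear.Build K M M _ (@Sn_act K n M X) (@Sn_actDr K n M X).

Section Submodules.
Variables (K : fieldType) (n : nat) (M : Sn_module K n).

Record submodule := Submodule {
  sm_pred :> M -> Prop;
  sm0 : sm_pred 0;
  smD : forall (a : K) u v, sm_pred u -> sm_pred v -> sm_pred (a *: u + v);
  sm_act : forall X v, sm_pred v -> sm_pred (Sn_act X v) }.

Variable N : submodule.

Definition sm_bool : {pred M} := fun v => `[< N v >].

Lemma sm_boolP v : reflect (N v) (v \in sm_bool).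
Proof. exact: asboolP. Qed.

Fact sm_bool_submod : submod_closed sm_bool.
Proof.
split=> [|a u v]; first exact/sm_boolP/sm0.
by move=> /sm_boolP hu /sm_boolP hv; apply/sm_boolP/smD.
Qed.
HB.instance Definition _ := GRing.isSubmodClosed.Build K M sm_bool sm_bool_submod.

Record sub_space := SubVect { sub_val :> M; sub_valP : sub_val \in sm_bool }.
HB.instance Definition _ := [isSub for sub_val].
HB.instance Definition _ := [Choice of sub_space by <:].
HB.instance Definition _ := [SubChoice_isSubLmodule of sub_space by <:].

Fact sub_act_subproof X (v : sub_space) : Sn_act X (sub_val v) \in sm_bool.
Proof. by have /sm_boolP hv := sub_valP v; apply/sm_boolP/sm_act. Qed.

Definition sub_act X (v : sub_space) : sub_space := SubVect (sub_act_subproof X v).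

Fact sub_actDl a X Y v : sub_act (a *: X + Y) v = a *: sub_act X v + sub_act Y v.
Proof. by apply: val_inj; rewrite /= Sn_actDl. Qed.
Fact sub_actDr X : linear (sub_act X).
Proof. by move=> a u v; apply: val_inj; rewrite /= Sn_actDr. Qed.
Fact sub_actB X Y v :
  sub_act (Sn_bracket X Y) v = sub_act X (sub_act Y v) - sub_act Y (sub_act X v).
Proof. by apply: val_inj; rewrite /= Sn_actB. Qed.

Definition submod : Sn_module K n := @SnModule K n sub_space sub_act sub_actDl sub_actDr sub_actB.

Definition quot_space := Quotient.quot sm_bool.
HB.instance Definition _ := Choice.on quot_space.
HB.instance Definition _ := GRing.Zmodule.on quot_space.

Definition to_quot (v : M) : quot_space := \pi_(Quotient.quot sm_bool) v.

Lemma to_quot_eq (u v : M) : to_quot u = to_quot v <-> N (u - v).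
Proof.
split=> [eq_uv|/sm_boolP]; last by rewrite Quotient.idealrBE => /eqP.
by apply/sm_boolP; rewrite Quotient.idealrBE; apply/eqP.
Qed.

Lemma to_quotD (u v : M) : to_quot (u + v) = to_quot u + to_quot v.
Proof. by rewrite /to_quot !piE. Qed.

Lemma to_quot_repr (x : quot_space) : to_quot (repr x) = x.
Proof. exact: reprK. Qed.

Definition quot_scale (a : K) (x : quot_space) : quot_space := to_quot (a *: repr x).
Definition quot_act X (x : quot_space) : quot_space := to_quot (Sn_act X (repr x)).

Lemma quot_scaleE a v : quot_scale a (to_quot v) = to_quot (a *: v).
Proof.
apply/to_quot_eq; rewrite -scalerBr -[X in N X]addr0; apply: smD; last exact: sm0.
by apply/to_quot_eq; rewrite to_quot_repr.
Qed.

Lemma quot_actE X v : quot_act X (to_quot v) = to_quot (Sn_act X v).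
Proof.
apply/to_quot_eq; rewrite -linearB; apply: sm_act.
by apply/to_quot_eq; rewrite to_quot_repr.
Qed.

Lemma quotP (x : quot_space) : exists v, x = to_quot v.
Proof. by exists (repr x); rewrite to_quot_repr. Qed.

Fact quot_scaleA a b x : quot_scale a (quot_scale b x) = quot_scale (a * b) x.
Proof. by have [v ->] := quotP x; rewrite !quot_scaleE scalerA. Qed.
Fact quot_scale1 : left_id 1 quot_scale.
Proof. by move=> x; have [v ->] := quotP x; rewrite quot_scaleE scale1r. Qed.
Fact quot_scaleDr : right_distributive quot_scale +%R.
Proof.
move=> a x y; have [u ->] := quotP x; have [v ->] := quotP y.
by rewrite -to_quotD !quot_scaleE -to_quotD scalerDr.
Qed.
Fact quot_scaleDl x : {morph quot_scale^~ x : a b / a + b}.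
Proof.
by move=> a b; have [v ->] := quotP x; rewrite !quot_scaleE -to_quotD scalerDl.
Qed.
HB.instance Definition _ := GRing.Zmodule_isLmodule.Build K quot_space
  quot_scaleA quot_scale1 quot_scaleDr quot_scaleDl.

Fact to_quot_is_linear : linear to_quot.
Proof. by move=> a u v; rewrite to_quotD -quot_scaleE. Qed.
HB.instance Definition _ :=
  GRing.isLinear.Build K M quot_space _ to_quot to_quot_is_linear.

Fact quot_actDl a X Y x : quot_act (a *: X + Y) x = a *: quot_act X x + quot_act Y x.
Proof. by have [v ->] := quotP x; rewrite !quot_actE -linearP Sn_actDl. Qed.
Fact quot_actDr X : linear (quot_act X).
Proof.
move=> a x y; have [u ->] := quotP x; have [v ->] := quotP y.
by rewrite -linearP !quot_actE -linearP Sn_actDr.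
Qed.
Fact quot_actB X Y x : quot_act (Sn_bracket X Y) x =
  quot_act X (quot_act Y x) - quot_act Y (quot_act X x).
Proof. by have [v ->] := quotP x; rewrite !quot_actE -linearB Sn_actB. Qed.

Definition quotmod : Sn_module K n :=
  @SnModule K n quot_space quot_act quot_actDl quot_actDr quot_actB.

End Submodules.

Section ModuleNotions.
Variables (K : fieldType) (n : nat).
Implicit Types M W : Sn_module K n.

Definition Sn_hom M W (f : {linear M -> W}) :=
  forall X v, f (Sn_act X v) = Sn_act X (f v).

Definition Sn_iso M W := exists f : {linear M -> W}, bijective f /\ Sn_hom f.

Definition trivial_module M := forall X (v : M), Sn_act X v = 0.

Definition irreducible M :=
  (exists v : M, v <> 0) /\
  forall N : submodule M, (forall v, N v -> v = 0) \/ (forall v, N v).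

Definition subquotient M W :=
  exists (N : submodule M) (L : submodule (submod N)), Sn_iso W (quotmod L).

Definition nontrivial_irr_subquotient M W :=
  [/\ subquotient M W, irreducible W & ~ trivial_module W].

Section HomImage.
Variables (M W : Sn_module K n) (f : {linear M -> W}) (fP : Sn_hom f).

Fact hom_image0 : exists u, f u = 0. Proof. by exists 0; rewrite linear0. Qed.
Fact hom_imageD (a : K) v w :
  (exists u, f u = v) -> (exists u, f u = w) -> exists u, f u = a *: v + w.
Proof. by move=> [u <-] [u' <-]; exists (a *: u + u'); rewrite linearP. Qed.
Fact hom_image_act X v : (exists u, f u = v) -> exists u, f u = Sn_act X v.
Proof. by move=> [u <-]; exists (Sn_act X u); rewrite fP. Qed.

Definition hom_image : submodule W :=
  @Submodule K n W (fun v => exists u, f u = v) hom_image0 hom_imageD hom_image_act.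
End HomImage.

End ModuleNotions.

(* V (x) Lambda^r K^n, for a K-vector space V: the element                     *)
(*   \sum_S f S (x) (e_{j_1} /\ ... /\ e_{j_r}),  S = {j_1 < ... < j_r},       *)
(* is represented by the family f of its coefficients; Lambda^r K^n itself is  *)
(* the case V = K^o.                                                           *)
Section Exterior.
Variables (K : fieldType) (n : nat).

Definition rset (r : nat) := {S : {set 'I_n} | #|S| == r}.

Definition Ext (V : lmodType K) (r : nat) := {ffun rset r -> V}.
HB.instance Definition _ V r := GRing.Lmodule.on (Ext V r).

Definition pure_tensor (V : lmodType K) r (p : V) (v : Ext K^o r) : Ext V r :=
  [ffun S => (v S : K) *: p].

Section Operators.
Variable V : lmodType K.
Implicit Types (i j l s : 'I_n) (S T : {set 'I_n}).

Definition ecoef r (f : Ext V r) S : V := if insub S is Some S' then f S' else 0.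

Definition ksign l S : K := (-1) ^+ #|[set s in S | (s < l)%N]|.

(* 1 (x) (e_l /\ _), from Lambda^q to Lambda^r; only meaningful for r = q + 1. *)
Definition wedge q r l (f : Ext V q) : Ext V r :=
  [ffun T : rset r => let T : {set 'I_n} := val T in
     if l \in T then ksign l T *: ecoef f (T :\ l) else 0].

(* The contraction with the i-th coordinate form, i.e. the antiderivation      *)
(* that maps e_j to (i == j); only meaningful for r = q + 1.                   *)
Definition contract q r i (f : Ext V r) : Ext V q :=
  [ffun S : rset q => let S : {set 'I_n} := val S in
     if i \in S then 0 else ksign i S *: ecoef f (i |: S)].

(* The action of the matrix unit E_{si} on Lambda^r: the derivation of the     *)
(* exterior algebra that maps e_j to (i == j) e_s (see mx_unit_wedge).         *)
Definition mx_unit r s i (f : Ext V r) : Ext V r :=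
  wedge r s (contract r.-1 i f).

Lemma ecoefE r (f : Ext V r) (S : rset r) : ecoef f (val S) = f S.
Proof. by rewrite /ecoef valK. Qed.

Lemma ecoef_neq r (f : Ext V r) S : #|S| != r -> ecoef f S = 0.
Proof. by move=> neS; rewrite /ecoef insubN. Qed.

Lemma ecoefP r (f g : Ext V r) : (forall S, ecoef f S = ecoef g S) -> f = g.
Proof. by move=> fg; apply/ffunP => S; rewrite -!ecoefE. Qed.

Fact ecoef_is_linear r S : linear (fun f : Ext V r => ecoef f S).
Proof.
move=> a f g; rewrite /ecoef; case: insub => [S'|]; first by rewrite !ffunE.
by rewrite scaler0 addr0.
Qed.

Lemma ecoefDZ r (a : K) (f g : Ext V r) S : ecoef (a *: f + g) S = a *: ecoef f S + ecoef g S.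
Proof. exact: ecoef_is_linear. Qed.
Lemma ecoef0 r S : ecoef (0 : Ext V r) S = 0.
Proof. by rewrite /ecoef; case: insub => // S'; rewrite ffunE. Qed.
Lemma ecoefD r (f g : Ext V r) S : ecoef (f + g) S = ecoef f S + ecoef g S.
Proof. by have:= ecoefDZ 1 f g S; rewrite !scale1r. Qed.
Lemma ecoefZ r (a : K) (f : Ext V r) S : ecoef (a *: f) S = a *: ecoef f S.
Proof. by have:= ecoefDZ a f 0 S; rewrite ecoef0 !addr0. Qed.
Lemma ecoefN r (f : Ext V r) S : ecoef (- f) S = - ecoef f S.
Proof. by have:= ecoefZ (-1) f S; rewrite !scaleN1r. Qed.

Fact wedge_is_linear q r l : linear (wedge r l : Ext V q -> Ext V r).
Proof.
move=> a f g; apply/ffunP => T; rewrite !ffunE /=; case: ifP => _.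
  by rewrite ecoefDZ scalerDr !scalerA mulrC.
by rewrite scaler0 addr0.
Qed.
HB.instance Definition _ q r l :=
  GRing.isLinear.Build K (Ext V q) (Ext V r) _ (@wedge q r l) (@wedge_is_linear q r l).

Fact contract_is_linear q r i : linear (contract q i : Ext V r -> Ext V q).
Proof.
move=> a f g; apply/ffunP => T; rewrite !ffunE /=; case: ifP => _.
  by rewrite scaler0 addr0.
by rewrite ecoefDZ scalerDr !scalerA mulrC.
Qed.
HB.instance Definition _ q r i :=
  GRing.isLinear.Build K (Ext V r) (Ext V q) _ (@contract q r i) (@contract_is_linear q r i).

Fact mx_unit_is_linear r s i : linear (@mx_unit r s i).
Proof. by move=> a f g; rewrite /mx_unit !linearP. Qed.
HB.instance Definition _ r s i :=
  GRing.isLinear.Build K (Ext V r) (Ext V r) _ (@mx_unit r s i) (@mx_unit_is_linear r s i).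

Lemma ecoef_wedge q l (f : Ext V q) T :
  ecoef (wedge q.+1 l f) T = if l \in T then ksign l T *: ecoef f (T :\ l) else 0.
Proof.
have [cT|neT] := eqVneq #|T| q.+1.
  by rewrite -[T in LHS]/(val (exist (fun T => #|T| == q.+1) T (introT eqP cT)))
             ecoefE ffunE.
rewrite ecoef_neq //; case: ifP => // lT; rewrite ecoef_neq ?scaler0 //.
by apply: contraNneq neT => cT; rewrite (cardsD1 l) lT cT.
Qed.

Lemma ecoef_contract q i (f : Ext V q.+1) S :
  ecoef (contract q i f) S = if i \in S then 0 else ksign i S *: ecoef f (i |: S).
Proof.
have [cS|neS] := eqVneq #|S| q.
  by rewrite -[S in LHS]/(val (exist (fun T => #|T| == q) S (introT eqP cS)))
             ecoefE ffunE.
rewrite ecoef_neq //; case: ifPn => // iS; rewrite ecoef_neq ?scaler0 //.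
by rewrite cardsU1 iS eqSS.
Qed.

Lemma ksignU l j S : j \notin S -> ksign l (j |: S) = (-1) ^+ (j < l)%N * ksign l S.
Proof.
move=> jS; rewrite /ksign -exprD; congr (_ ^+ _); case: ltnP => jl.
  rewrite (_ : [set _ in _ | _] = j |: [set s in S | (s < l)%N]).
    by rewrite cardsU1 inE (negPf jS).
  by apply/setP => k; rewrite !inE; case: eqP => // ->; rewrite jl.
rewrite add0n; apply: eq_card => k; rewrite !inE.
by case: eqP => // ->; rewrite ltnNge jl /= andbF.
Qed.

Lemma ksignD l j S : j \in S -> ksign l (S :\ j) = (-1) ^+ (j < l)%N * ksign l S.
Proof.
move=> jS; rewrite -[in RHS](setD1K jS) ksignU ?setD11 // mulrA -exprD addnn.
by rewrite -signr_odd odd_double mul1r.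
Qed.

Lemma ksign_anti (l j : 'I_n) (a b : K) : l != j ->
  (-1) ^+ (l < j)%N * a * b = - ((-1) ^+ (j < l)%N * b * a).
Proof.
move=> lj; rewrite -mulNr -mulNr -mulrA (mulrC a) mulrA.
by case: ltngtP lj => [|_ _|/val_inj -> /eqP //]; rewrite ?opprK // ?mulN1r ?mul1r.
Qed.

Lemma wedge_anti q l j (f : Ext V q) :
  wedge q.+2 l (wedge q.+1 j f) = - wedge q.+2 j (wedge q.+1 l f).
Proof.
apply: ecoefP => T; rewrite ecoefN !ecoef_wedge !inE.
have [<-|ne] := eqVneq l j; first by rewrite ?eqxx /= ?scaler0 ?if_same oppr0.
rewrite /=; case: ifP => lT; case: ifP => jT; rewrite ?scaler0 ?oppr0 //.
rewrite !ksignD // !scalerA -scaleNr setDDl setUC -setDDl; congr (_ *: _).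
by rewrite mulrC [in RHS]mulrC; apply: ksign_anti.
Qed.

Lemma contract_anti q i j (f : Ext V q.+2) :
  contract q i (contract q.+1 j f) = - contract q j (contract q.+1 i f).
Proof.
apply: ecoefP => S; rewrite ecoefN !ecoef_contract !inE.
have [<-|ne] := eqVneq i j; first by rewrite ?eqxx /= ?scaler0 ?if_same oppr0.
rewrite /=; case: ifPn => iS; case: ifPn => jS; rewrite ?scaler0 ?oppr0 //.
rewrite !ksignU // !scalerA -scaleNr setUCA; congr (_ *: _).
by rewrite mulrC [in RHS]mulrC; apply: ksign_anti.
Qed.

Lemma rset0 (S : rset 0) : val S = set0.
Proof. by apply/eqP; rewrite -cards_eq0 (valP S). Qed.

Lemma wedge_to0 q l (f : Ext V q) : wedge 0 l f = 0.
Proof. by apply/ffunP => S; rewrite !ffunE /= rset0 inE. Qed.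

Lemma contract0 q i (f : Ext V 0) : contract q i f = 0.
Proof.
apply/ffunP => S; rewrite !ffunE /=; case: ifP => // iS.
by rewrite ecoef_neq ?scaler0 // cardsU1 iS.
Qed.

Lemma ksignK l S : ksign l S * ksign l S = 1.
Proof. by rewrite /ksign -exprD addnn -signr_odd odd_double. Qed.

Lemma contract_wedge q i j (f : Ext V q) :
  contract q i (wedge q.+1 j f) = (i == j)%:R *: f - wedge q j (contract q.-1 i f).
Proof.
apply: ecoefP => S; rewrite ecoefD ecoefZ ecoefN ecoef_contract ecoef_wedge.
have -> : ecoef (wedge q j (contract q.-1 i f)) S =
    if j \in S then ksign j S *:
      (if i \in S :\ j then 0 else ksign i (S :\ j) *: ecoef f (i |: (S :\ j)))
    else 0.
  case: q f => [|q] f; last by rewrite ecoef_wedge ecoef_contract.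
  rewrite wedge_to0 ecoef0; case: ifP => // jS; case: ifPn => [|iS]; rewrite ?scaler0 //.
  by rewrite ecoef_neq ?scaler0 // cardsU1 iS.
rewrite !inE; have [<-|ne] /= := eqVneq i j.
  rewrite scale1r; case: ifPn => iS; last first.
    by rewrite subr0 ksignU // ltnn mul1r scalerA ksignK scale1r setU1K.
  by rewrite ksignD // ltnn mul1r scalerA ksignK scale1r setD1K // subrr.
rewrite scale0r sub0r; case: ifPn => iS.
  by rewrite scaler0 if_same oppr0.
case: ifPn => jS; last by rewrite scaler0 oppr0.
rewrite !scalerA -scaleNr; congr (_ *: ecoef f _); last first.
  by apply/setP => k; rewrite !inE; case: (eqVneq k i) => [->|]; rewrite ?ne.
by rewrite ksignU // ksignD // mulrC [in RHS]mulrC; apply: ksign_anti.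
Qed.

Lemma mx_unit0 s i (f : Ext V 0) : mx_unit s i f = 0.
Proof. exact: wedge_to0. Qed.

(* The Leibniz rule E_{si} (e_l /\ f) = (E_{si} e_l) /\ f + e_l /\ E_{si} f. *)
Lemma mx_unit_wedge q s i l (f : Ext V q) :
  mx_unit s i (wedge q.+1 l f) =
    (i == l)%:R *: wedge q.+1 s f + wedge q.+1 l (mx_unit s i f).
Proof.
rewrite /mx_unit contract_wedge linearB linearZ /=; congr (_ + _).
case: q f => [|q] f; first by rewrite !wedge_to0 !linear0 ?oppr0.
by rewrite wedge_anti opprK.
Qed.

Lemma mx_unit_bracket r s i t j (f : Ext V r) :
  mx_unit s i (mx_unit t j f) - mx_unit t j (mx_unit s i f) =
    (i == t)%:R *: mx_unit s j f - (j == s)%:R *: mx_unit t i f.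
Proof.
case: r f => [|r] f; first by rewrite !mx_unit0 !scaler0.
rewrite [X in mx_unit s i X]/mx_unit [X in mx_unit t j X]/mx_unit !mx_unit_wedge /=.
rewrite opprD addrACA -[RHS]addr0; congr (_ + _).
case: r f => [|r] f; first by rewrite !mx_unit0 !linear0 addr0.
by rewrite /mx_unit /= wedge_anti (contract_anti i j) !linearN /= opprK subrr.
Qed.

End Operators.
End Exterior.

Lemma zmod_regroup (V : zmodType) (a b m e a' b' e' : V) :
  (a + b + m + e) - (a' + b' + m + e') = (a - a') + ((b - b') + (e - e')).
Proof. by rewrite !opprD [LHS]addrACA [X in X + _]addrACA subrr addr0 [X in X + _]addrACA -addrA. Qed.

Lemma exchange4 (V : nmodType) (I J : finType) (G : I -> J -> I -> J -> V) :
  \sum_s \sum_i \sum_t \sum_j G s i t j = \sum_t \sum_j \sum_s \sum_i G s i t j.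
Proof.
under eq_bigr => s _ do rewrite exchange_big /=.
rewrite exchange_big; apply: eq_bigr => t _ /=.
under eq_bigr => s _ do rewrite exchange_big /=.
by rewrite exchange_big.
Qed.

Section ShenLarsson.
Variables (K : fieldType) (n : nat) (P : weyl_module K n).
Implicit Types (X Y : {ffun 'I_n -> {mpoly K[n]}}).

(* A (x) 1. *)
Definition coefwise r (A : P -> P) (f : Ext n P r) : Ext n P r := [ffun S => A (f S)].

Fact coefwise_is_linear r (A : {linear P -> P}) : linear (@coefwise r A).
Proof. by move=> a f g; apply/ffunP => S; rewrite !ffunE linearP. Qed.
HB.instance Definition _ r (A : {linear P -> P}) :=
  GRing.isLinear.Build K (Ext n P r) (Ext n P r) _ (@coefwise r A) (@coefwise_is_linear r A).

Lemma ecoef_coefwise r (A : {linear P -> P}) (f : Ext n P r) S :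
  ecoef (coefwise A f) S = A (ecoef f S).
Proof. by rewrite /ecoef; case: insub => [S'|]; rewrite ?ffunE ?linear0. Qed.

Lemma wedge_coefwise q r l (A : {linear P -> P}) (f : Ext n P q) :
  wedge r l (coefwise A f) = coefwise A (wedge r l f).
Proof.
apply/ffunP => S; rewrite !ffunE /=; case: ifP => _; last by rewrite linear0.
by rewrite ecoef_coefwise linearZ.
Qed.

Lemma contract_coefwise q r i (A : {linear P -> P}) (f : Ext n P r) :
  contract q i (coefwise A f) = coefwise A (contract q i f).
Proof.
apply/ffunP => S; rewrite !ffunE /=; case: ifP => _; first by rewrite linear0.
by rewrite ecoef_coefwise linearZ.
Qed.

Lemma mx_unit_coefwise r s i (A : {linear P -> P}) (f : Ext n P r) :
  mx_unit s i (coefwise A f) = coefwise A (mx_unit s i f).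
Proof. by rewrite /mx_unit contract_coefwise wedge_coefwise. Qed.

(* The vector field \sum_i (X i) d_i, as an element of D_n. *)
Definition vf_act X (v : P) : P := \sum_i poly_act (X i) (wd P i v).

Fact vf_act_is_linear X : linear (vf_act X).
Proof.
move=> a u v; rewrite /vf_act scaler_sumr -big_split; apply: eq_bigr => i _.
by rewrite !linearP.
Qed.
HB.instance Definition _ X := GRing.isLinear.Build K P P _ (vf_act X) (vf_act_is_linear X).

Definition SL_act r X (f : Ext n P r) : Ext n P r :=
  coefwise (vf_act X) f
  + \sum_s \sum_i coefwise (poly_act (mderiv s (X i))) (mx_unit s i f).

Definition SL_map r (f : Ext n P r) : Ext n P r.+1 :=
  \sum_l coefwise (wd P l) (wedge r.+1 l f).

(* The next lemmas check, on pure tensors, that SL_act and SL_map are         *)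
(*   X (p (x) v) = \sum_i (X i d_i p) (x) v                                   *)
(*                 + \sum_{s,i} (d_s (X i) p) (x) E_{si} v,                   *)
(*   p (x) v |-> \sum_l d_l p (x) (e_l /\ v).                                 *)
Lemma coefwise_pure r (A : {linear P -> P}) p (v : Ext n K^o r) :
  coefwise A (pure_tensor p v) = pure_tensor (A p) v.
Proof. by apply/ffunP => S; rewrite !ffunE linearZ. Qed.

Lemma ecoef_pure r (p : P) (v : Ext n K^o r) S :
  ecoef (pure_tensor p v) S = (ecoef v S : K) *: p.
Proof. by rewrite /ecoef; case: insub => [S'|]; rewrite ?ffunE ?scale0r. Qed.

Lemma wedge_pure q r l (p : P) (v : Ext n K^o q) :
  wedge r l (pure_tensor p v) = pure_tensor p (wedge r l v).
Proof.
apply/ffunP => S; rewrite !ffunE /=; case: ifP => _; last by rewrite scale0r.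
by rewrite ecoef_pure scalerA.
Qed.

Lemma contract_pure q r i (p : P) (v : Ext n K^o r) :
  contract q i (pure_tensor p v) = pure_tensor p (contract q i v).
Proof.
apply/ffunP => S; rewrite !ffunE /=; case: ifP => _; first by rewrite scale0r.
by rewrite ecoef_pure scalerA.
Qed.

Lemma mx_unit_pure r s i (p : P) (v : Ext n K^o r) :
  mx_unit s i (pure_tensor p v) = pure_tensor p (mx_unit s i v).
Proof. by rewrite /mx_unit contract_pure wedge_pure. Qed.

Lemma SL_act_pure r X (p : P) (v : Ext n K^o r) :
  SL_act X (pure_tensor p v) =
    \sum_i pure_tensor (poly_act (X i) (wd P i p)) v
    + \sum_s \sum_i pure_tensor (poly_act (mderiv s (X i)) p) (mx_unit s i v).
Proof.
rewrite /SL_act coefwise_pure; congr (_ + _).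
  by apply/ffunP => S; rewrite sum_ffunE ffunE scaler_sumr; apply: eq_bigr => i _; rewrite ffunE.
by do 2!apply: eq_bigr => ? _; rewrite mx_unit_pure coefwise_pure.
Qed.

Lemma SL_map_pure r (p : P) (v : Ext n K^o r) :
  SL_map (pure_tensor p v) = \sum_l pure_tensor (wd P l p) (wedge r.+1 l v).
Proof. by apply: eq_bigr => l _; rewrite wedge_pure coefwise_pure. Qed.

Fact SL_act_is_linear r X : linear (@SL_act r X).
Proof.
move=> a f g; rewrite /SL_act linearP scalerDr addrACA; congr (_ + _).
rewrite scaler_sumr -big_split; apply: eq_bigr => s _.
rewrite scaler_sumr -big_split; apply: eq_bigr => i _.
by rewrite !linearP.
Qed.
HB.instance Definition _ r X :=
  GRing.isLinear.Build K (Ext n P r) (Ext n P r) _ (@SL_act r X) (@SL_act_is_linear r X).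

Fact SL_map_is_linear r : linear (@SL_map r).
Proof.
move=> a f g; rewrite /SL_map scaler_sumr -big_split; apply: eq_bigr => l _.
by rewrite !linearP.
Qed.
HB.instance Definition _ r :=
  GRing.isLinear.Build K (Ext n P r) (Ext n P r.+1) _ (@SL_map r) (@SL_map_is_linear r).

Fact vf_actDZ a X Y v : vf_act (a *: X + Y) v = a *: vf_act X v + vf_act Y v.
Proof.
rewrite /vf_act scaler_sumr -big_split; apply: eq_bigr => i _.
by rewrite !ffunE poly_actDZ.
Qed.

Fact SL_actDZ r a X Y (f : Ext n P r) :
  SL_act (a *: X + Y) f = a *: SL_act X f + SL_act Y f.
Proof.
rewrite /SL_act scalerDr addrACA; congr (_ + _).
  by apply/ffunP => S; rewrite !ffunE vf_actDZ.
rewrite scaler_sumr -big_split; apply: eq_bigr => s _.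
rewrite scaler_sumr -big_split; apply: eq_bigr => i _.
by apply/ffunP => S; rewrite !ffunE mderivD mderivZ poly_actDZ.
Qed.

Definition vf_der X p : {mpoly K[n]} := \sum_j X j * mderiv j p.

Lemma vf_act_poly X p v :
  vf_act X (poly_act p v) = poly_act (vf_der X p) v + poly_act p (vf_act X v).
Proof.
rewrite /vf_act linear_sum poly_act_sum -big_split; apply: eq_bigr => i _ /=.
by rewrite wd_poly_act linearD poly_actM (poly_actC p).
Qed.

Lemma wd_vf_act X l v :
  wd P l (vf_act X v) = vf_act X (wd P l v) + \sum_i poly_act (mderiv l (X i)) (wd P i v).
Proof.
rewrite /vf_act linear_sum -big_split; apply: eq_bigr => i _ /=.
by rewrite wd_poly_act addrC wdC.
Qed.

Lemma vf_bracketE X Y i : vf_bracket X Y i = vf_der X (Y i) - vf_der Y (X i).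
Proof. by rewrite ffunE sumrB. Qed.

Fact vf_act_bracket X Y v :
  vf_act (vf_bracket X Y) v = vf_act X (vf_act Y v) - vf_act Y (vf_act X v).
Proof.
pose H X Y := \sum_i \sum_j poly_act (Y i * X j) (wd P j (wd P i v)).
have E X' Y' : vf_act X' (vf_act Y' v) =
    \sum_i poly_act (vf_der X' (Y' i)) (wd P i v) + H X' Y'.
  rewrite [vf_act Y' v]/vf_act linear_sum -big_split; apply: eq_bigr => i _ /=.
  rewrite vf_act_poly; congr (_ + _); rewrite /vf_act linear_sum.
  by apply: eq_bigr => j _; rewrite poly_actM.
have HC : H X Y = H Y X.
  rewrite /H exchange_big; do 2!apply: eq_bigr => ? _ /=.
  by rewrite mulrC wdC.
rewrite !E HC opprD addrACA subrr addr0 -sumrB; apply: eq_bigr => i _.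
by rewrite vf_bracketE poly_actB.
Qed.

Definition SL_jac r X (f : Ext n P r) : Ext n P r :=
  \sum_s \sum_i coefwise (poly_act (mderiv s (X i))) (mx_unit s i f).

Lemma coefwise_sum r I (t : seq I) (A : I -> P -> P) (f : Ext n P r) :
  \sum_(k <- t) coefwise (A k) f = coefwise (fun v => \sum_(k <- t) A k v) f.
Proof. by apply/ffunP => S; rewrite sum_ffunE ffunE; apply: eq_bigr => k _; rewrite ffunE. Qed.

Lemma coefwise_vf_jac r X Y (f : Ext n P r) :
  coefwise (vf_act X) (SL_jac Y f) =
    \sum_s \sum_i coefwise (poly_act (vf_der X (mderiv s (Y i)))) (mx_unit s i f)
    + SL_jac Y (coefwise (vf_act X) f).
Proof.
rewrite linear_sum -big_split; apply: eq_bigr => s _ /=.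
rewrite linear_sum -big_split; apply: eq_bigr => i _ /=.
by apply/ffunP => S; rewrite mx_unit_coefwise !ffunE vf_act_poly.
Qed.

Lemma SL_jacC r X Y (f : Ext n P r) :
  SL_jac X (SL_jac Y f) - SL_jac Y (SL_jac X f) =
  \sum_s \sum_j coefwise (poly_act (\sum_i
     (mderiv s (X i) * mderiv i (Y j) - mderiv s (Y i) * mderiv i (X j)))) (mx_unit s j f).
Proof.
pose F X Y s i t j : Ext n P r -> Ext n P r :=
  coefwise (poly_act (mderiv s (X i) * mderiv t (Y j))).
have E X' Y' : SL_jac X' (SL_jac Y' f) =
    \sum_s \sum_i \sum_t \sum_j F X' Y' s i t j (mx_unit s i (mx_unit t j f)).
  do 2!apply: eq_bigr => ? _; rewrite !linear_sum; apply: eq_bigr => t _ /=.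
  rewrite !linear_sum; apply: eq_bigr => j _ /=; rewrite mx_unit_coefwise.
  by apply/ffunP => S; rewrite !ffunE poly_actM.
have E' : SL_jac Y (SL_jac X f) =
    \sum_s \sum_i \sum_t \sum_j F X Y s i t j (mx_unit t j (mx_unit s i f)).
  rewrite E; apply: etrans (exchange4 _) _; do 4!apply: eq_bigr => ? _.
  by rewrite /F mulrC.
rewrite E E'.
transitivity (\sum_s \sum_i \sum_t \sum_j
   ((i == t)%:R *: F X Y s i t j (mx_unit s j f)
    - (j == s)%:R *: F X Y s i t j (mx_unit t i f))).
  do 4![rewrite -sumrB; apply: eq_bigr => ? _].
  by rewrite /F -linearB mx_unit_bracket linearB !linearZ.
transitivity (\sum_s \sum_i \sum_t \sum_j (i == t)%:R *: F X Y s i t j (mx_unit s j f)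
  - \sum_s \sum_i \sum_t \sum_j (j == s)%:R *: F X Y s i t j (mx_unit t i f)).
  by do 4![rewrite -sumrB; apply: eq_bigr => ? _].
have delta (I : finType) (k : I) (G : I -> Ext n P r) :
    \sum_t (k == t)%:R *: G t = G k.
  rewrite (bigD1 k) //= eqxx scale1r big1 ?addr0 // => t.
  by rewrite eq_sym => /negPf ->; rewrite scale0r.
have -> : \sum_s \sum_i \sum_t \sum_j (i == t)%:R *: F X Y s i t j (mx_unit s j f) =
    \sum_s \sum_j \sum_i F X Y s i i j (mx_unit s j f).
  apply: eq_bigr => s _; rewrite [RHS]exchange_big; apply: eq_bigr => i _ /=.
  by rewrite exchange_big; apply: eq_bigr => j _ /=; rewrite delta.
have -> : \sum_s \sum_i \sum_t \sum_j (j == s)%:R *: F X Y s i t j (mx_unit t i f) =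
    \sum_t \sum_i \sum_s F X Y s i t s (mx_unit t i f).
  rewrite exchange_big [RHS]exchange_big; apply: eq_bigr => i _ /=.
  rewrite exchange_big; apply: eq_bigr => t _ /=.
  apply: eq_bigr => s _; under eq_bigr => j _ do rewrite eq_sym.
  exact: delta.
rewrite -sumrB; apply: eq_bigr => s _; rewrite -sumrB; apply: eq_bigr => j _.
rewrite -sumrB; apply/ffunP => S; rewrite sum_ffunE !ffunE poly_act_sum.
apply: eq_bigr => i _; rewrite !ffunE poly_actB; congr (_ - poly_act _ _).
by rewrite mulrC.
Qed.

Fact SL_act_bracket r X Y (f : Ext n P r) :
  SL_act (vf_bracket X Y) f = SL_act X (SL_act Y f) - SL_act Y (SL_act X f).
Proof.
have E X' Y' : SL_act X' (SL_act Y' f) =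
    coefwise (vf_act X') (coefwise (vf_act Y') f)
    + \sum_s \sum_i coefwise (poly_act (vf_der X' (mderiv s (Y' i)))) (mx_unit s i f)
    + (SL_jac Y' (coefwise (vf_act X') f) + SL_jac X' (coefwise (vf_act Y') f))
    + SL_jac X' (SL_jac Y' f).
  rewrite {1}/SL_act -/(SL_jac X' _) [SL_act Y' f]/SL_act -/(SL_jac Y' f).
  rewrite linearD /= coefwise_vf_jac.
  have -> : SL_jac X' (coefwise (vf_act Y') f + SL_jac Y' f) =
      SL_jac X' (coefwise (vf_act Y') f) + SL_jac X' (SL_jac Y' f).
    rewrite -big_split; apply: eq_bigr => s _ /=.
    rewrite -big_split; apply: eq_bigr => i _ /=.
    by rewrite !linearD.
  by rewrite !addrA.
rewrite !E [SL_jac X (coefwise _ _) + _]addrC.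
apply: etrans (esym (zmod_regroup _ _ _ _ _ _ _)); rewrite SL_jacC /SL_act; congr (_ + _).
  by apply/ffunP => S; rewrite !ffunE vf_act_bracket.
rewrite -sumrB -big_split; apply: eq_bigr => s _ /=.
rewrite -sumrB -big_split; apply: eq_bigr => i _ /=.
apply/ffunP => S; rewrite !ffunE -poly_actB -poly_actD; congr (poly_act _ _).
rewrite linear_sum -!sumrB -big_split; apply: eq_bigr => j _ /=.
rewrite mderivB !mderivM !(mderiv_comm j s) opprD addrACA addrC; congr (_ + _).
Qed.


End ShenLarsson.

Lemma sum_alternating (V : zmodType) n (G : 'I_n -> 'I_n -> V) :
  (forall l s, G l s = - G s l) -> (forall l, G l l = 0) ->
  \sum_l \sum_s G l s = 0.
Proof.
move=> GN G0; pose H (l s : 'I_n) := if (l < s)%N then G l s else 0.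
have GE l s : G l s = H l s - H s l.
  rewrite /H; case: ltngtP => [_|_|/val_inj ->].
  - by rewrite subr0.
  - by rewrite sub0r GN.
  - by rewrite G0 subr0.
under eq_bigr => l _ do (under eq_bigr => s _ do rewrite GE; rewrite sumrB).
by rewrite sumrB [X in _ - X]exchange_big subrr.
Qed.

Section Modules.
Variables (K : fieldType) (n : nat) (P : weyl_module K n).

Fact SL_map_act r (X : Sn K n) (f : Ext n P r) : SL_map (SL_act X f) = SL_act X (SL_map f).
Proof.
have wedge_sq l (g : Ext n P r.-1) :
    wedge r.+1 l (wedge r l g) = 0.
  case: r f g => [|r] _ g; first by rewrite wedge_to0 linear0.
  apply: ecoefP => S; rewrite ecoef0 !ecoef_wedge !inE eqxx /= scaler0.
  by rewrite if_same.
have wedge_antisym l s (g : Ext n P r.-1) :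
    wedge r.+1 l (wedge r s g) = - wedge r.+1 s (wedge r l g).
  case: r f g wedge_sq => [|r] _ g _; last exact: wedge_anti.
  by rewrite !wedge_to0 !linear0 ?oppr0.
have jac : SL_map (SL_jac X f) =
    \sum_l \sum_s \sum_i coefwise (poly_act (mderiv s (X i)))
       (wedge r.+1 l (mx_unit s i (coefwise (wd P l) f))).
  transitivity (\sum_l \sum_s (\sum_i coefwise (poly_act (mderiv s (X i)))
       (wedge r.+1 l (mx_unit s i (coefwise (wd P l) f)))
     + \sum_i coefwise (poly_act (mderiv l (mderiv s (X i))))
       (wedge r.+1 l (mx_unit s i f)))).
    apply: eq_bigr => l _; rewrite !linear_sum; apply: eq_bigr => s _ /=.
    rewrite !linear_sum -big_split; apply: eq_bigr => i _ /=.
    rewrite wedge_coefwise mx_unit_coefwise wedge_coefwise.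
    by apply/ffunP => S; rewrite !ffunE wd_poly_act addrC.
  transitivity (\sum_l \sum_s \sum_i coefwise (poly_act (mderiv s (X i)))
       (wedge r.+1 l (mx_unit s i (coefwise (wd P l) f)))
     + \sum_l \sum_s \sum_i coefwise (poly_act (mderiv l (mderiv s (X i))))
       (wedge r.+1 l (mx_unit s i f))).
    by rewrite -big_split; apply: eq_bigr => l _; rewrite -big_split.
  rewrite [X in _ + X]sum_alternating ?addr0 // => l.
    move=> s; rewrite -sumrN; apply: eq_bigr => i _.
    by rewrite /mx_unit wedge_antisym linearN /= mderiv_comm.
  by apply: big1 => i _; rewrite /mx_unit wedge_sq linear0.
have -> : SL_map (SL_act X f) = SL_map (coefwise (vf_act X) f) + SL_map (SL_jac X f).
  exact: linearD.
have -> : SL_act X (SL_map f) = coefwise (vf_act X) (SL_map f) + SL_jac X (SL_map f).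
  by [].
have -> : SL_map (coefwise (vf_act X) f) = coefwise (vf_act X) (SL_map f)
    + \sum_s \sum_i coefwise (poly_act (mderiv s (X i)))
        (wedge r.+1 s (coefwise (wd P i) f)).
  rewrite linear_sum -big_split; apply: eq_bigr => l _ /=.
  rewrite wedge_coefwise; apply/ffunP => S; rewrite !ffunE wd_vf_act sum_ffunE.
  by congr (_ + _); apply: eq_bigr => i _; rewrite wedge_coefwise !ffunE.
rewrite -addrA jac; congr (_ + _).
transitivity (\sum_s \sum_i \sum_l coefwise (poly_act (mderiv s (X i)))
   ((i == l)%:R *: wedge r.+1 s (coefwise (wd P l) f)
    + wedge r.+1 l (mx_unit s i (coefwise (wd P l) f)))); last first.
  apply: eq_bigr => s _; apply: eq_bigr => i _; rewrite !linear_sum.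
  by apply: eq_bigr => l _ /=; rewrite -wedge_coefwise mx_unit_wedge.
rewrite [X in _ + X]exchange_big -big_split; apply: eq_bigr => s _ /=.
rewrite [X in _ + X]exchange_big -big_split; apply: eq_bigr => i _ /=.
under [RHS]eq_bigr => l _ do rewrite linearD linearZ /=.
rewrite big_split; congr (_ + _).
rewrite (bigD1 i) //= eqxx scale1r big1 ?addr0 // => l.
by rewrite eq_sym => /negPf ->; rewrite scale0r.
Qed.

(* P as an S_n-module, through the inclusion of S_n in D_n. *)
Definition nat_module : Sn_module K n :=
  @SnModule K n P (fun X => vf_act X) (fun a X Y => vf_actDZ a X Y)
    (fun X => vf_act_is_linear X) (fun X Y => vf_act_bracket X Y).

(* The Shen-Larsson module F(P, V(delta_r)). *)
Definition SL_module r : Sn_module K n :=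
  @SnModule K n (Ext n P r) (fun X => @SL_act K n P r X)
    (fun a X Y => @SL_actDZ K n P r a X Y) (fun X => @SL_act_is_linear K n P r X)
    (fun X Y => @SL_act_bracket K n P r X Y).

Definition SL_pi r : {linear SL_module r -> SL_module r.+1} := @SL_map K n P r.

Fact SL_pi_hom r : Sn_hom (SL_pi r).
Proof. by move=> X f; apply: SL_map_act. Qed.

(* L_n(P, r); only meaningful for 1 <= r. *)
Definition Ln r : Sn_module K n := submod (hom_image (@SL_pi_hom r.-1)).

Fact Delta0 : exists w : 'I_n -> P, 0 = \sum_i wd P i (w i).
Proof. by exists (fun=> 0); rewrite big1 // => i _; rewrite linear0. Qed.

Fact DeltaD (a : K) (u v : P) :
  (exists w, u = \sum_i wd P i (w i)) -> (exists w, v = \sum_i wd P i (w i)) ->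
  exists w, a *: u + v = \sum_i wd P i (w i).
Proof.
move=> [w ->] [w' ->]; exists (fun i => a *: w i + w' i).
by rewrite scaler_sumr -big_split; apply: eq_bigr => i _; rewrite linearP.
Qed.

Fact Delta_act (X : Sn K n) (v : nat_module) :
  (exists w : 'I_n -> P, v = \sum_i wd P i (w i)) ->
  exists w : 'I_n -> P, Sn_act X v = \sum_i wd P i (w i).
Proof.
move=> [w ->]; exists (fun i => vf_act X (w i) - \sum_j poly_act (mderiv j (X i)) (w j)).
rewrite linear_sum /=.
under [RHS]eq_bigr => i _ do rewrite linearB wd_vf_act linear_sum /=.
rewrite sumrB big_split /= -[LHS]addr0 -addrA; congr (_ + _).
apply/esym/eqP; rewrite subr_eq0; apply/eqP.
under [RHS]eq_bigr => i _ do
  under eq_bigr => j _ do rewrite wd_poly_act mderiv_comm.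
rewrite [RHS]exchange_big /=; apply: eq_bigr => l _.
by rewrite big_split /= -poly_act_sum -linear_sum Sn_div linear0 poly_act0 add0r.
Qed.

Definition Delta : submodule nat_module :=
  @Submodule K n nat_module (fun v => exists w : 'I_n -> P, v = \sum_i wd P i (w i))
    Delta0 DeltaD Delta_act.

Lemma SL_module0 : Sn_iso (SL_module 0) nat_module.
Proof.
pose S0 : rset n 0 := exist _ set0 (introT eqP (cards0 _)).
have S0E S : S = S0 by apply: val_inj; rewrite rset0.
pose ev (f : Ext n P 0) : P := f S0.
have ev_lin : linear ev by move=> a f g; rewrite /ev !ffunE.
pose evL : {linear SL_module 0 -> nat_module} :=
  HB.pack (ev : SL_module 0 -> nat_module) (GRing.isLinear.Build _ _ _ _ ev ev_lin).
exists evL; split.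
  exists (fun v => [ffun=> v] : Ext n P 0) => [f|v]; last by rewrite /= /ev ffunE.
  by apply/ffunP => S; rewrite ffunE (S0E S).
move=> X f; rewrite /= /ev /SL_act !ffunE big1 ?ffunE ?addr0 // => s _.
by apply: big1 => i _; rewrite mx_unit0 linear0.
Qed.

End Modules.

Section Constants.
Variables (K : fieldType) (n : nat).

Fact const0 : exists c : K, 0 = c *: (1 : {mpoly K[n]}).
Proof. by exists 0; rewrite scale0r. Qed.

Fact constD (a : K) (p q : {mpoly K[n]}) :
  (exists c : K, p = c *: 1) -> (exists c : K, q = c *: 1) ->
  exists c : K, a *: p + q = c *: 1.
Proof. by move=> [c ->] [d ->]; exists (a * c + d); rewrite scalerA scalerDl. Qed.

Fact const_act (X : Sn K n) (p : nat_module (An K n)) :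
  (exists c : K, p = c *: (1 : {mpoly K[n]})) ->
  exists c : K, Sn_act X p = c *: (1 : {mpoly K[n]}).
Proof.
move=> [c ->]; exists 0; rewrite scale0r; apply: big1 => i _ /=.
by rewrite mderivZ -mpolyC1 mderivC scaler0 linear0.
Qed.

(* The line spanned by t^0 = 1. *)
Definition constants : submodule (nat_module (An K n)) :=
  @Submodule K n (nat_module (An K n)) (fun p => exists c : K, p = c *: (1 : {mpoly K[n]}))
    const0 constD const_act.

End Constants.

Arguments constants : clear implicits.

(* Main.v *)
(** The modules [F(P, V(delta_r))] form the de Rham complex of [P], with
    [e_l] in the role of [dt_l] and with [d = pi_r]. By Cartan's formula
    [L_X = d i_X + i_X d] the Lie algebra acts trivially on its cohomology, so
    the nontrivial irreducible subquotients of the 1-forms are those of the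
    0-forms [P] and those of [L_n(P, 2) = d(1-forms)]. For [n = 2] the 2-forms
    are again [P].

    Write [X_g] for the field [(d_i g) d_j - (d_j g) d_i], [i <> j].

    On [P], the identity [d_j X_(t_i g) - (t_i d_j) X_g = d_j g d_j] shows that
    if [N] is an [S_n]-submodule then [{w | d_j (g w) in N for all g}] is a
    [D_n]-submodule containing [d_j N]. As [P] is simple, either [N] is killed
    by all [d_j] or [N] contains [Delta P].

    On closed 2-forms [w], the same combination of fields applied to [w] equals
    [d(i_j d(g i_j w) + (d_j g) dt_i /\ i_j i_i w)]. For [n >= 3] the difference
    of two choices of [i] is [d(f (dt_i /\ i_j i_i w - dt_k /\ i_j i_k w))] with
    [f = d_j g] arbitrary. Hence, for a submodule [N] of [L_n(P, 2)], the forms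
    [th] with [d(f th) in N] for all [f] are a nonzero subspace of the 1-forms
    as soon as [N] is nonzero; it is stable under [D_n] and [sl_n], so it is
    everything. *)

From HB Require Import structures.
Require Import Defs.
From mathcomp Require Import all_boot all_order all_algebra.
From mathcomp Require Import boolp reals mpoly complex.

Set Implicit Arguments.
Unset Strict Implicit.
Unset Printing Implicit Defensive.

Import GRing.Theory.

(** * Subquotients of S_n-modules *)

Section Subquotients.
Local Open Scope ring_scope.
Variables (K : fieldType) (n : nat).
Implicit Types M W A B T Z : Sn_module K n.

Definition surj (U V : Type) (f : U -> V) := forall y, exists x, f x = y.

Lemma linear_bij (U V : lmodType K) (f : {linear U -> V}) :
  (forall x, f x = 0 -> x = 0) -> surj f -> bijective f.
Proof.
move=> finj fsurj; pose g y := sval (cid (fsurj y)).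
have fg y : f (g y) = y by rewrite /g; case: cid.
exists g => // x; apply/eqP; rewrite -subr_eq0; apply/eqP/finj.
by rewrite linearB fg subrr.
Qed.

(** The universal property of a quotient, for any surjection [f]: [h y] is [g] of a chosen preimage
    of [y], and the kernel condition makes the choice immaterial. *)
Lemma factor_hom M B W (f : {linear M -> B}) (g : {linear M -> W}) :
  Sn_hom f -> Sn_hom g -> surj f -> (forall x, f x = 0 -> g x = 0) ->
  exists2 h : {linear B -> W}, Sn_hom h & forall x, h (f x) = g x.
Proof.
move=> fP gP fsurj kerfg; pose h y := g (sval (cid (fsurj y))).
have hf x : h (f x) = g x.
  rewrite /h; case: cid => x' /= fx'; apply/eqP; rewrite -subr_eq0 -linearB.
  by apply/eqP/kerfg; rewrite linearB fx' subrr.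
have hlin : linear h.
  move=> a u v; have [x <-] := fsurj u; have [y <-] := fsurj v.
  by rewrite -linearP !hf linearP.
pose hL : {linear B -> W} := HB.pack (h : B -> W) (GRing.isLinear.Build _ _ _ _ h hlin).
exists hL => // X v; have [x <-] := fsurj v.
by rewrite -fP /= !hf gP.
Qed.

Lemma lift_hom A Z W (i : {linear Z -> W}) (g : {linear A -> W}) :
  Sn_hom i -> Sn_hom g -> injective i -> (forall x, exists z, i z = g x) ->
  exists2 h : {linear A -> Z}, Sn_hom h & forall x, i (h x) = g x.
Proof.
move=> iP gP i_inj im_g; pose h x := sval (cid (im_g x)).
have ih x : i (h x) = g x by rewrite /h; case: cid.
have hlin : linear h by move=> a u v; apply: i_inj; rewrite linearP !ih linearP.
pose hL : {linear A -> Z} := HB.pack (h : A -> Z) (GRing.isLinear.Build _ _ _ _ h hlin).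
by exists hL => // X v; apply: i_inj; rewrite iP /= !ih gP.
Qed.

Lemma Sn_iso_sym M W : Sn_iso M W -> Sn_iso W M.
Proof.
case=> f [[g fK gK] fP].
have fsurj : surj f by move=> y; exists (g y).
have [x fx0|h hP hf] := factor_hom fP (fun X v => erefl : idfun _ = _) fsurj.
  by apply: (can_inj fK); rewrite fx0 linear0.
by exists h; split=> //; exists f => // y; rewrite -[y in LHS]gK hf /= gK.
Qed.

Lemma Sn_iso_trans M B W : Sn_iso M B -> Sn_iso B W -> Sn_iso M W.
Proof.
case=> f [fb fP] [g [gb gP]]; exists (g \o f).
by split=> [|X v]; [exact: bij_comp | rewrite /= fP gP].
Qed.

(** A quotient of something embedded in [M]: this form of [subquotient] composes with homomorphisms
    and avoids submodules of submodules. *)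
Definition subquo M W := exists Z (i : {linear Z -> M}) (s : {linear Z -> W}),
  [/\ Sn_hom i, Sn_hom s, injective i & surj s].

Definition incl M (N : submodule M) : {linear submod N -> M} :=
  HB.pack (@sub_val K n M N : submod N -> M)
    (GRing.isLinear.Build _ _ _ _ (@sub_val K n M N : submod N -> M) (fun a u v => erefl)).

Definition qmap M (N : submodule M) : {linear M -> quotmod N} := @to_quot K n M N.

Lemma incl_hom M (N : submodule M) : Sn_hom (incl N).
Proof. by []. Qed.

Lemma incl_inj M (N : submodule M) : injective (incl N).
Proof. exact: val_inj. Qed.

Lemma qmap_hom M (N : submodule M) : Sn_hom (qmap N).
Proof. by move=> X v; rewrite /= quot_actE. Qed.

Lemma qmap_surj M (N : submodule M) : surj (qmap N).
Proof. by move=> x; have [v ->] := Defs.quotP x; exists v. Qed.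

Lemma qmap_eq0 M (N : submodule M) v : qmap N v = 0 <-> N v.
Proof. by rewrite -(linear0 (qmap N)) to_quot_eq subr0. Qed.

Section Kernel.
Variables (M W : Sn_module K n) (f : {linear M -> W}) (fP : Sn_hom f).

Fact hom_kernelD (a : K) u v : f u = 0 -> f v = 0 -> f (a *: u + v) = 0.
Proof. by move=> fu fv; rewrite linearP fu fv scaler0 addr0. Qed.
Fact hom_kernel_act X v : f v = 0 -> f (Sn_act X v) = 0.
Proof. by move=> fv; rewrite fP fv linear0. Qed.

Definition hom_kernel : submodule M :=
  @Submodule K n M (fun v => f v = 0) (linear0 f) hom_kernelD hom_kernel_act.

End Kernel.

Section Preimage.
Variables (M W : Sn_module K n) (f : {linear M -> W}) (fP : Sn_hom f) (N : submodule W).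

Fact hom_preim0 : N (f 0). Proof. by rewrite linear0; exact: sm0. Qed.
Fact hom_preimD (a : K) u v : N (f u) -> N (f v) -> N (f (a *: u + v)).
Proof. by rewrite linearP; exact: smD. Qed.
Fact hom_preim_act X v : N (f v) -> N (f (Sn_act X v)).
Proof. by rewrite fP; exact: sm_act. Qed.

Definition hom_preim : submodule M :=
  @Submodule K n M (fun v => N (f v)) hom_preim0 hom_preimD hom_preim_act.

End Preimage.

Lemma corestrict M W (f : {linear M -> W}) (fP : Sn_hom f) :
  exists g : {linear M -> submod (hom_image fP)},
    [/\ Sn_hom g, surj g & forall x, incl _ (g x) = f x].
Proof.
have [x|g gP ig] := lift_hom (@incl_hom _ (hom_image fP)) fP (@incl_inj _ _).
  by apply: (ex_intro _ (SubVect _)) => //=; apply/sm_boolP; exists x.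
exists g; split=> // y; have /sm_boolP[x fx] := sub_valP y.
by exists x; apply: incl_inj; rewrite ig fx.
Qed.

Lemma subquotientP M W : subquotient M W <-> subquo M W.
Proof.
split=> [[N [L /Sn_iso_sym[g [[h gK hK] gP]]]]|[Z [i [s [iP sP i_inj s_surj]]]]].
  exists (submod N), (incl N), (g \o qmap L); split=> //.
  - by move=> X v; rewrite /= -gP -quot_actE.
  - exact: incl_inj.
  by move=> y; have [v hv] := qmap_surj (h y); exists v; rewrite /= hv hK.
have [j [jP jsurj ji]] := corestrict iP.
have [z jz0|q qP qj] := factor_hom jP sP jsurj.
  by rewrite (_ : z = 0) ?linear0 //; apply: i_inj; rewrite -ji jz0 !linear0.
have q_surj : surj q by move=> y; have [z <-] := s_surj y; exists (j z).
exists (hom_image iP), (hom_kernel qP); apply: Sn_iso_sym.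
have [x /qmap_eq0 //|h hP hq] := factor_hom (@qmap_hom _ (hom_kernel qP)) qP (@qmap_surj _ _).
exists h; split=> //; apply: linear_bij => [x|y].
  by have [v ->] := Defs.quotP x; rewrite hq => qv0; apply/qmap_eq0.
by have [x <-] := q_surj y; exists (qmap _ x); rewrite hq.
Qed.

Lemma subquo_inj M B W (f : {linear M -> B}) :
  Sn_hom f -> injective f -> subquo M W -> subquo B W.
Proof.
move=> fP f_inj [Z [i [s [iP sP i_inj s_surj]]]]; exists Z, (f \o i), s; split=> //.
  by move=> X v; rewrite /= iP fP.
exact: inj_comp.
Qed.

Lemma subquo_surj M B W (f : {linear M -> B}) :
  Sn_hom f -> surj f -> subquo B W -> subquo M W.
Proof.
move=> fP f_surj [Z [i [s [iP sP i_inj s_surj]]]].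
pose N := hom_preim fP (hom_image iP).
have fNP : Sn_hom (f \o incl N) by move=> X v; rewrite /= -fP.
have [x|h hP ih] := lift_hom iP fNP i_inj; first by have /sm_boolP := sub_valP x.
exists (submod N), (incl N), (s \o h); split=> //.
- by move=> X v; rewrite /= hP sP.
- exact: incl_inj.
move=> w; have [z sz] := s_surj w; have [x fx] := f_surj (i z).
have xN : x \in sm_bool N by apply/sm_boolP; exists z.
by exists (SubVect xN); rewrite /= -sz; congr (s _); apply: i_inj; rewrite ih.
Qed.

(** The part of [Z] inside [N] has an image in the simple module [W]. If the image is [W], then [W]
    comes from [N]; if it is zero, [s] factors through the image of [Z] in [M / N]. *)
Lemma subquo_split M W (N : submodule M) : irreducible W -> subquo M W ->
  subquo (submod N) W \/ subquo (quotmod N) W.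
Proof.
move=> [_ W_simple] [Z [i [s [iP sP i_inj s_surj]]]].
pose Z0 := hom_preim iP N.
have siP : Sn_hom (s \o incl Z0) by move=> X v; rewrite /= -sP.
have [s0|sT] := W_simple (hom_image siP).
  right.
  have qiP : Sn_hom (qmap N \o i) by move=> X v; rewrite /= iP -quot_actE.
  have [j [jP jsurj ji]] := corestrict qiP.
  have [z jz0|q qP qj] := factor_hom jP sP jsurj.
    have zZ0 : z \in sm_bool Z0.
      by apply/sm_boolP; apply/(qmap_eq0 N (i z)); rewrite -[LHS]ji jz0 linear0.
    by apply: s0; exists (SubVect zZ0).
  exists (submod (hom_image qiP)), (incl _), q; split=> //; first exact: incl_inj.
  by move=> y; have [z <-] := s_surj y; exists (j z).
left.
have iZP : Sn_hom (i \o incl Z0) by move=> X v; rewrite /= -iP.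
have [z|h hP ih] := lift_hom (@incl_hom _ N) iZP (@incl_inj _ _).
  by exists (@SubVect _ _ _ N (i (incl Z0 z)) (sub_valP z)).
exists (submod Z0), h, (s \o incl Z0); split=> //.
by move=> u v /(congr1 (incl N)); rewrite !ih => /i_inj/incl_inj.
Qed.

Lemma subquo_trivial M W : trivial_module M -> subquo M W -> trivial_module W.
Proof.
move=> Mt [Z [i [s [iP sP i_inj s_surj]]]] X w; have [z <-] := s_surj w.
by rewrite -sP (_ : Sn_act X z = 0) ?linear0 //; apply: i_inj; rewrite iP Mt linear0.
Qed.

(** Simplicity forces the image of [Z] to be [M] and the kernel of [s] to be zero, so [i] and [s]
    are isomorphisms. *)
Lemma subquo_irreducible M W : irreducible M -> irreducible W -> subquo M W -> Sn_iso W M.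
Proof.
move=> [_ M_simple] [[w w0] W_simple] [Z [i [s [iP sP i_inj s_surj]]]].
have [z sz] := s_surj w.
have [i0|iT] := M_simple (hom_image iP).
  case: w0; rewrite -sz (_ : z = 0) ?linear0 //; apply: i_inj.
  by rewrite linear0; apply: i0; exists z.
have isP : Sn_hom (i \o incl (hom_kernel sP)) by move=> X v; rewrite /= -iP.
have [k0|kT] := M_simple (hom_image isP); last first.
  have [x ix] := kT (i z); case: w0; rewrite -sz -(i_inj _ _ ix).
  by have /sm_boolP := sub_valP x.
have s_inj x : s x = 0 -> x = 0.
  move=> sx; have xK : x \in sm_bool (hom_kernel sP) by apply/sm_boolP.
  by apply: i_inj; rewrite linear0; apply: k0; exists (SubVect xK).
apply: (@Sn_iso_trans _ Z).
  by apply: Sn_iso_sym; exists s; split=> //; apply: linear_bij.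
exists i; split=> //; apply: linear_bij => // x ix0.
by apply: i_inj; rewrite ix0 linear0.
Qed.

Lemma subquo_iso M W T : Sn_iso W T -> subquo M T -> subquo M W.
Proof.
move=> /Sn_iso_sym[f [[g fK gK] fP]] [Z [i [s [iP sP i_inj s_surj]]]].
exists Z, i, (f \o s); split=> // [X v|w]; first by rewrite /= sP fP.
by have [z sz] := s_surj (g w); exists z; rewrite /= sz gK.
Qed.

Lemma subquo_sub M (N : submodule M) : subquo M (submod N).
Proof.
exists (submod N), (incl N), idfun; split=> //; first exact: incl_inj.
by move=> x; exists x.
Qed.

Lemma subquo_image A M T (f : {linear A -> M}) (g : {linear A -> T}) :
  Sn_hom f -> Sn_hom g -> surj g -> (forall x, f x = 0 -> g x = 0) -> subquo M T.
Proof.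
move=> fP gP g_surj kerfg; have [j [jP jsurj fj]] := corestrict fP.
have [x jx0|h hP hj] := factor_hom jP gP jsurj.
  by apply: kerfg; rewrite -fj jx0 linear0.
exists (submod (hom_image fP)), (incl _), h; split=> //; first exact: incl_inj.
by move=> y; have [x <-] := g_surj y; exists (j x).
Qed.

Lemma subquo_split_hom M B W (f : {linear M -> B}) (fP : Sn_hom f) :
  irreducible W -> subquo M W -> subquo (submod (hom_kernel fP)) W \/ subquo B W.
Proof.
move=> W_irr /(subquo_split (hom_kernel fP) W_irr)[|sq]; [by left | right].
have [x /qmap_eq0 //|h hP hq] := factor_hom (@qmap_hom _ (hom_kernel fP)) fP (@qmap_surj _ _).
apply: subquo_inj hP _ sq => u v huv; apply/eqP; rewrite -subr_eq0; apply/eqP.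
have [x xE] := qmap_surj (u - v); rewrite -xE; apply/qmap_eq0.
by rewrite /= -hq xE linearB huv subrr.
Qed.

Lemma irreducibleI M : ~ trivial_module M ->
  (forall N : submodule M, (forall v, N v -> v = 0) \/ (forall v, N v)) -> irreducible M.
Proof.
move=> Mt M_simple; split=> //; apply: contrapT => M0; apply: Mt => X v.
by apply: contrapT => Xv; apply: M0; exists (Sn_act X v).
Qed.

Lemma trivial_iso M W : Sn_iso M W -> trivial_module W -> trivial_module M.
Proof.
case=> f [/bij_inj f_inj fP] Wt X v; apply: f_inj.
by rewrite fP Wt linear0.
Qed.

Lemma irreducible_iso M W : Sn_iso M W -> irreducible W -> irreducible M.
Proof.
case=> f [[g fK gK] fP] [[w w0] W_simple]; split.
  by exists (g w) => gw0; apply: w0; rewrite -[w]gK gw0 linear0.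
move=> N; have NP : Sn_hom (f \o incl N) by move=> X v; rewrite /= -fP.
have [N0|NT] := W_simple (hom_image NP); [left | right] => v.
  move=> Nv; have vN : v \in sm_bool N by apply/sm_boolP.
  by apply: (can_inj fK); rewrite linear0; apply: N0; exists (SubVect vN).
have [x fx] := NT (f v); rewrite -(can_inj fK fx).
by have /sm_boolP := sub_valP x.
Qed.

Lemma nontrivial_irr_subquotientI M T W : irreducible T -> ~ trivial_module T ->
  subquo M T -> Sn_iso W T -> nontrivial_irr_subquotient M W.
Proof.
move=> T_irr Tt sqT WT; split; first by apply/subquotientP/(subquo_iso WT).
  exact: irreducible_iso WT T_irr.
by move=> Wt; apply/Tt/trivial_iso/Wt/Sn_iso_sym.
Qed.

End Subquotients.

(** * Submodules of P *)

Lemma exists_neq (n : nat) (j : 'I_n) : (2 <= n)%N -> exists i : 'I_n, i != j.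
Proof.
move=> n2; pose i0 := Ordinal (ltnW n2); pose i1 := Ordinal n2.
by have [<-|] := eqVneq i0 j; [exists i1 | exists i0].
Qed.

Section Fields.
Local Open Scope ring_scope.
Variables (K : fieldType) (n : nat).

Lemma sum_delta (V : lmodType K) (j : 'I_n) (F : 'I_n -> V) :
  \sum_k (k == j)%:R *: F k = F j.
Proof.
rewrite (bigD1 j) //= eqxx scale1r big1 ?addr0 // => k /negPf ->.
by rewrite scale0r.
Qed.

Fact shear_div (j : 'I_n) (q : {mpoly K[n]}) : mderiv j q = 0 ->
  [ffun k => (k == j)%:R *: q] \in @div_free K n.
Proof.
move=> q0; rewrite div_freeE /divergence; apply/eqP.
by under eq_bigr => k _ do rewrite ffunE linearZ /=; rewrite sum_delta.
Qed.

Definition shear j q (q0 : mderiv j q = 0) : Sn K n := SnField (shear_div q0).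

Fact ham_div (i j : 'I_n) (g : {mpoly K[n]}) :
  [ffun k => (k == j)%:R *: mderiv i g - (k == i)%:R *: mderiv j g] \in @div_free K n.
Proof.
rewrite div_freeE /divergence; apply/eqP.
under eq_bigr => k _ do rewrite ffunE linearB !linearZ /=.
by rewrite big_split /= !sum_delta mderiv_comm subrr.
Qed.

(* The field X_g of the introduction. *)
Definition ham i j g : Sn K n := SnField (ham_div i j g).

Variable P : weyl_module K n.

Lemma vf_act_shear j q (v : P) :
  vf_act [ffun k => (k == j)%:R *: q] v = poly_act q (wd P j v).
Proof.
rewrite /vf_act; under eq_bigr => k _ do rewrite ffunE poly_actZ.
by rewrite sum_delta.
Qed.

Lemma vf_act_ham i j g (v : P) :
  vf_act (ham i j g) v = poly_act (mderiv i g) (wd P j v) - poly_act (mderiv j g) (wd P i v).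
Proof.
rewrite /vf_act; under eq_bigr => k _ do rewrite ffunE poly_actB !poly_actZ.
by rewrite sumrB !sum_delta.
Qed.

Lemma mderiv1 j : mderiv j (1 : {mpoly K[n]}) = 0.
Proof. by rewrite -mpolyC1 mderivC. Qed.

Lemma mderiv_var_neq i j : i != j -> mderiv j ('X_i : {mpoly K[n]}) = 0.
Proof. by rewrite mderiv_var eq_sym => /negPf ->. Qed.

Lemma wd_wt i (v : P) : wd P i (wt P i v) = wt P i (wd P i v) + v.
Proof. by have := wdt i i v; rewrite eqxx scale1r => /(canRL (subrK _)) ->; rewrite addrC. Qed.

Lemma wd_wt_neq i j (v : P) : i != j -> wd P i (wt P j v) = wt P j (wd P i v).
Proof. by move=> /negPf ij; apply/eqP; rewrite -subr_eq0 wdt ij scale0r. Qed.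

Section Submodule.
Variable N : submodule (nat_module P).

Lemma sm_sub (u v : P) : N u -> N v -> N (u - v).
Proof. by move=> Nu Nv; rewrite addrC -scaleN1r; exact: smD. Qed.

Lemma sm_add (u v : P) : N u -> N v -> N (u + v).
Proof. by move=> Nu Nv; rewrite -[u]scale1r; exact: smD. Qed.

Lemma sm_wd j v : N v -> N (wd P j v).
Proof.
by move=> /(sm_act (shear (mderiv1 j))); rewrite /= vf_act_shear poly_act1.
Qed.

Lemma sm_wt_wd i j v : i != j -> N v -> N (wt P i (wd P j v)).
Proof.
move=> /mderiv_var_neq ij /(sm_act (shear ij)).
by rewrite /= vf_act_shear poly_actX.
Qed.

Lemma sm_wd_poly_wd i j g v : i != j -> N v -> N (wd P j (poly_act g (wd P j v))).
Proof.
move=> ij Nv.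
suff -> : wd P j (poly_act g (wd P j v)) =
    wd P j (vf_act (ham i j ('X_i * g)) v) - wt P i (wd P j (vf_act (ham i j g) v)).
  by apply: sm_sub; [apply: sm_wd | apply: sm_wt_wd => //]; apply: (sm_act (ham _ _ _) Nv).
(* By Leibniz [X_(t_i g) = g d_j + t_i X_g], and [t_i] commutes with [d_j]. *)
have -> : vf_act (ham i j ('X_i * g)) v =
    poly_act g (wd P j v) + wt P i (vf_act (ham i j g) v).
  rewrite !vf_act_ham !mderivM mderiv_var eqxx mul1r (mderiv_var_neq ij) mul0r add0r.
  by rewrite poly_actD !poly_actM !poly_actX linearB addrA.
by rewrite linearD wd_wt_neq 1?eq_sym // addrK.
Qed.

Lemma Delta_sub j v : (2 <= n)%N -> D_simple P -> N v -> wd P j v <> 0 ->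
  forall u, Delta P u -> N u.
Proof.
move=> n2 [_ P_simple] Nv jv0.
have Nj u : N (wd P j u).
  (* [Q] is stable under [d_i] because [g d_i = d_i g - (d_i g)]. It contains [d_j v <> 0], hence is
     all of [P], and [g = 1] gives the claim. *)
  pose Q w := forall g, N (wd P j (poly_act g w)).
  suff QD : D_submodule Q.
    have [Q0|QT] := P_simple _ QD; last by have := QT u 1; rewrite poly_act1.
    have [i ij] := exists_neq j n2.
    by case: jv0; apply: Q0 => g; apply: sm_wd_poly_wd ij Nv.
  split=> [g|a u1 u2 Q1 Q2 g|i w Qw g|i w Qw g].
  - by rewrite !linear0; exact: sm0.
  - by have := smD a (Q1 g) (Q2 g); rewrite -!linearP.
  - by rewrite -poly_actX -poly_actM.
  have -> : poly_act g (wd P i w) = wd P i (poly_act g w) - poly_act (mderiv i g) w.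
    by rewrite wd_poly_act addrC addKr.
  by rewrite linearB wdC; apply: sm_sub; first apply: sm_wd.
have Ni i u : N (wd P i u).
  have [->|ij] := eqVneq i j; first exact: Nj.
  (* Both [t_j d_i d_j u] and [d_j t_j d_i u] lie in [N], and they differ by [d_i u]. *)
  have : N (wt P j (wd P i (wd P j u))) by apply: sm_wt_wd => //; rewrite eq_sym.
  have -> : wt P j (wd P i (wd P j u)) = wd P j (wt P j (wd P i u)) - wd P i u.
    by rewrite wd_wt wdC addrK.
  move=> /(sm_sub (Nj (wt P j (wd P i u)))).
  by rewrite opprB addrC subrK.
move=> u [w ->]; elim: (index_enum _) => [|i s IH].
  by rewrite big_nil; exact: sm0.
by rewrite big_cons; apply: sm_add.
Qed.

End Submodule.

End Fields.

(** * Weyl modules in characteristic 0 *)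

Section WeylModuleTheory.
Local Open Scope ring_scope.
Variables (K : fieldType) (n : nat).
Hypothesis K_char0 : [pchar K] =i pred0.
Implicit Types (P Q : weyl_module K n).

Lemma natS_neq0 k : k.+1%:R != 0 :> K.
Proof. by move/pcharf0P: K_char0 => ->. Qed.

Lemma D_iso_sym P Q : D_iso P Q -> D_iso Q P.
Proof.
case=> f [[g fK gK] ft fd]; have glin : linear g := can2_linear fK gK.
pose gL : {linear Q -> P} := HB.pack (g : Q -> P) (GRing.isLinear.Build _ _ _ _ g glin).
exists gL; split=> [|i v|i v]; first by exists f.
  by apply: (can_inj fK); rewrite ft /= !gK.
by apply: (can_inj fK); rewrite fd /= !gK.
Qed.

Lemma D_submodule_poly_act P (N : P -> Prop) p v :
  D_submodule N -> N v -> N (poly_act p v).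
Proof.
case=> N0 ND Nt _ Nv; elim/mpolyind: p => [|a m p _ _ IH]; first by rewrite poly_act0.
rewrite poly_actDZ; apply: ND => //; rewrite poly_actXm /mon_act.
by elim: (enum _) => //= i s; elim: (m i) => //= k IHk Ns; apply/Nt/IHk.
Qed.

Lemma An_poly_act p (q : An K n) : poly_act p q = p * q.
Proof.
elim/mpolyind: p => [|a m p _ _ IH]; first by rewrite poly_act0 mul0r.
rewrite poly_actDZ IH mulrDl -scalerAl; congr (_ *: _ + _) => {p IH}.
pose good p := forall q : An K n, poly_act p q = p * q.
apply: (_ : good _); rewrite mpolyXE_id; apply: big_ind => [r|p1 p2 g1 g2 r|i _].
- by rewrite poly_act1 mul1r.
- by rewrite poly_actM g1 g2 mulrA.
elim: (m i) => [|k IH] r; first by rewrite expr0 poly_act1 mul1r.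
by rewrite exprS poly_actM IH poly_actX /= /An_t mulrA.
Qed.

Lemma mderiv_eq0 (p : {mpoly K[n]}) : (forall i, mderiv i p = 0) -> p = p@_0%MM *: 1.
Proof.
move=> p0; apply/mpolyP => m; rewrite mcoeffZ mcoeff1.
have [->|m0] := eqVneq m 0%MM; first by rewrite mulr1.
have [i mi] : exists i, m i != 0%N.
  apply/existsP; apply: contraNT m0; rewrite negb_exists => /forallP m0.
  by apply/eqP/mnmP => i; rewrite mnm0E; apply/eqP/negPn.
rewrite mulr0; apply/eqP; have /mpolyP/(_ (m - U_(i))%MM) := p0 i.
rewrite mcoeff_mderiv mcoeff0 submK ?lep1mP // -mulr_natr => /eqP.
by rewrite mulf_eq0 (negPf (natS_neq0 _)) orbF.
Qed.

Lemma mderiv_surj j (p : {mpoly K[n]}) : exists q, mderiv j q = p.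
Proof.
elim/mpolyind: p => [|a m p _ _ [q <-]]; first by exists 0; rewrite mderiv0.
exists ((a / (m j).+1%:R) *: 'X_[m + U_(j)] + q).
rewrite mderivD mderivZ mderivX addmK mnmDE mnm1E eqxx addn1.
by rewrite scalerA mulfVK ?natS_neq0.
Qed.

Lemma An_D_simple : D_simple (An K n).
Proof.
split=> [|N [N0 ND Nt Nd]]; first by exists 1; apply/eqP/oner_neq0.
have [[p [Np p0]]|allN] := pselect (exists p, N p /\ p <> 0); [right | left]; last first.
  by move=> v Nv; apply: contrapT => v0; apply: allN; exists v.
suff N1 : N 1.
  by move=> v; rewrite -[v]mulr1 -An_poly_act; apply: D_submodule_poly_act.
(* Differentiation lowers the degree, so induction on a degree bound ends in a nonzero constant of
   [N]. *)
have [k] : exists k, forall m, m \in msupp p -> (mdeg m < k)%N.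
  by exists (msize p) => m /msize_mdeg_lt.
elim: k p Np p0 => [|k IH] p Np p0 szp.
  case: p0; apply/mpolyP => m; rewrite mcoeff0; apply: memN_msupp_eq0.
  by apply/negP => /szp.
have [[i di]|allp] := pselect (exists i, mderiv i p <> 0).
  apply: (IH _ (Nd i _ Np) di) => m; rewrite mcoeff_msupp mcoeff_mderiv => nz.
  have : (m + U_(i))%MM \in msupp p.
    by rewrite mcoeff_msupp; apply: contraNneq nz => ->; rewrite mul0rn.
  by move/szp; rewrite mdegD mdeg1 addn1 ltnS.
have pE : p = p@_0%MM *: 1.
  by apply: mderiv_eq0 => i; apply: contrapT => di; apply: allp; exists i.
have c0 : p@_0%MM != 0 by apply/eqP => c0; case: p0; rewrite pE c0 scale0r.
have := ND (p@_0%MM)^-1 _ _ Np N0.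
by rewrite addr0 [in X in _ *: X]pE scalerA mulVf // scale1r.
Qed.

(** As the [d_i] kill [v], the map [p |-> p v] is [D_n]-linear on [An]; being nonzero between simple
    modules, it is bijective. *)
Lemma D_iso_An P v : D_simple P -> v <> 0 -> (forall i, wd P i v = 0) -> D_iso P (An K n).
Proof.
move=> [_ P_simple] v0 dv0; apply: D_iso_sym.
pose f (p : An K n) : P := poly_act p v.
have flin : linear f by move=> a p q; rewrite /f poly_actDZ.
pose fL : {linear An K n -> P} :=
  HB.pack (f : An K n -> P) (GRing.isLinear.Build _ _ _ _ f flin).
have ft i p : fL (wt (An K n) i p) = wt P i (fL p).
  by rewrite /= /f /An_t poly_actM poly_actX.
have fd i p : fL (wd (An K n) i p) = wd P i (fL p).
  by rewrite /= /f wd_poly_act dv0 linear0 addr0.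
exists fL; split=> //; apply: linear_bij.
  have [_ An_simple] := An_D_simple.
  have [|kerf|kerT] := An_simple (fun p => fL p = 0); last 1 first.
  - by case: v0; rewrite -(kerT 1) /= /f poly_act1.
  - split=> [|a p q fp fq|i p fp|i p fp]; rewrite ?linear0 //.
    + by rewrite linearP fp fq scaler0 addr0.
    + by rewrite ft fp linear0.
    + by rewrite fd fp linear0.
  exact: kerf.
have [|im0|//] := P_simple (fun u => exists p, fL p = u).
  split=> [|a _ _ [p <-] [q <-]|i _ [p <-]|i _ [p <-]].
  - by exists 0; rewrite linear0.
  - by exists (a *: p + q); rewrite linearP.
  - by exists (wt (An K n) i p).
  - by exists (wd (An K n) i p).
by case: v0; apply: im0; exists 1; rewrite /= /f poly_act1.
Qed.

Lemma wd_inj P v : D_simple P -> ~ D_iso P (An K n) -> (forall i, wd P i v = 0) -> v = 0.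
Proof. by move=> Ps PA dv0; apply: contrapT => v0; apply/PA/D_iso_An/dv0. Qed.

Lemma twistF_D_simple P : D_simple P -> D_simple (twistF P).
Proof.
move=> [Pn0 P_simple]; split=> // N [N0 ND Nt Nd]; apply: P_simple.
split=> // i v Nv; rewrite -[wt P i v]addr0 -[wt P i v]opprK -scaleN1r.
by apply: ND => //; apply: Nd.
Qed.

(** [F] has order 4, so three twists invert one: on the threefold twist [Q], [d_i] acts as [t_i] on
    [P] and kills [v], whence [Q] is isomorphic to [An]. *)
Lemma D_iso_twistF P v : D_simple P -> v <> 0 -> (forall i, wt P i v = 0) ->
  D_iso P (twistF (An K n)).
Proof.
move=> Ps v0 tv0; pose Q := twistF (twistF (twistF P)).
have Qs : D_simple Q by do 3!apply: twistF_D_simple.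
have [i|f [fbij ft fd]] := @D_iso_An Q v Qs v0.
  by rewrite /= /opp_t /= /opp_t tv0 !oppr0.
exists f; split=> // i u.
  by rewrite -[RHS](fd i) /= /opp_t /= /opp_t opprK.
apply: oppr_inj; rewrite -(linearN f).
exact: etrans (ft i u) (esym (opprK _)).
Qed.

(* A weight vector outside Delta P has t_i d_i acting by -1 for all i, so that
   d_i kills t_i v while d_i is not locally nilpotent on v. *)
Lemma Delta_full P : D_simple P -> D_weight P -> ~ D_iso P (twistF (An K n)) ->
  forall v, Delta P v.
Proof.
move=> Ps Pw PF; pose D := Delta P.
have D_wd i u : D (wd P i u).
  exists (fun k => (k == i)%:R *: u).
  by under eq_bigr => k _ do rewrite linearZ /=; rewrite sum_delta.
suff Dw w : weight_vector w -> D w.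
  move=> v; have [s [sw ->]] := Pw v; elim: s sw => [|w s IH] sw.
    by rewrite big_nil; exact: sm0.
  rewrite big_cons; apply: (@sm_add K n P D).
    by apply/Dw/sw; rewrite inE eqxx.
  by apply: IH => u us; apply: sw; rewrite inE us orbT.
move=> w_wt; apply: contrapT => Dw.
have tdw i : wt P i (wd P i w) = - w.
  have [b bw] := w_wt i.
  (* [d_i t_i w = (b + 1) w] lies in [Delta P], and so would [w] unless [b = -1]. *)
  have [b1|b1] := eqVneq b (-1); first by rewrite bw b1 scaleN1r.
  case: Dw; have := D_wd i (wt P i w); rewrite wd_wt bw -[in X in _ + X](scale1r w).
  rewrite -scalerDl => /(smD (b + 1)^-1)/(_ (sm0 _)).
  by rewrite addr0 scalerA mulVf ?scale1r // addr_eq0.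
have w0 : w <> 0 by move=> w0; apply: Dw; rewrite w0; exact: sm0.
apply: PF; apply: (D_iso_twistF Ps w0) => i.
have dtw : wd P i (wt P i w) = 0 by rewrite wd_wt tdw addNr.
apply: contrapT => tw0; have [_ P_simple] := Ps.
(* The vectors killed by a power of [d_i] form a [D_n]-submodule; it contains [t_i w <> 0], hence
   also [w]. *)
pose N u := exists k, iter k (wd P i) u = 0.
have it_lin k (a : K) u v : iter k (wd P i) (a *: u + v)
    = a *: iter k (wd P i) u + iter k (wd P i) v.
  by elim: k => //= k ->; rewrite linearP.
have it_0 k : iter k (wd P i) 0 = 0 by elim: k => //= k ->; rewrite linear0.
have it_t k u : iter k (wd P i) (wt P i u) =
    wt P i (iter k (wd P i) u) + k%:R *: iter k.-1 (wd P i) u.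
  elim: k => [|k IH]; first by rewrite scale0r addr0.
  rewrite [LHS]/= IH linearD wd_wt linearZ /= -addrA; congr (_ + _).
  case: k {IH} => [|k]; first by rewrite scale0r addr0 scale1r.
  by rewrite /= -[in X in X + _](scale1r (wd P i _)) -scalerDl nat1r.
have [|N0|NT] := P_simple N.
- split=> [|a u v [k ku] [l lv]|j v [k kv]|j v [k kv]].
  + by exists 0%N.
  + exists (k + l)%N.
    by rewrite it_lin (iterD k l _ v) lv it_0 addnC iterD ku it_0 scaler0 addr0.
  + have [<-|ij] := eqVneq i j.
      by exists k.+1; rewrite it_t /= kv !linear0 addr0.
    exists k; have it_tj l : iter l (wd P i) (wt P j v) = wt P j (iter l (wd P i) v).
      by elim: l => //= l ->; rewrite wd_wt_neq.
    by rewrite it_tj kv linear0.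
  + exists k; have -> : iter k (wd P i) (wd P j v) = wd P j (iter k (wd P i) v).
      by elim: (k) => //= l ->; rewrite wdC.
    by rewrite kv linear0.
- by apply: tw0; apply: N0; exists 1%N.
have [k kw] := NT w; elim: k kw => [|k IH] kw; first exact: w0.
(* With [t_i d_i w = - w] and [d_i^(k+1) w = 0] this reads [- d_i^k w = k d_i^k w], so
   [(k + 1) d_i^k w = 0]. *)
apply: IH; have := it_t k (wd P i w).
rewrite tdw -iterSr kw linear0 add0r.
have -> : iter k (wd P i) (- w) = - iter k (wd P i) w.
  by have := it_lin k (-1) w 0; rewrite it_0 !addr0 !scaleN1r.
case: k kw => [|k] kw; first by rewrite scale0r /= => /eqP; rewrite oppr_eq0 => /eqP.
rewrite -iterSr => /esym/eqP; rewrite -subr_eq0 opprK.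
rewrite -[X in _ + X]scale1r -scalerDl natr1.
by rewrite scaler_eq0 (negPf (natS_neq0 _)) => /eqP.
Qed.

End WeylModuleTheory.

(** * Cartan's formula and closed 2-forms *)

Section DeRham.
Local Open Scope ring_scope.
Variables (K : fieldType) (n : nat) (P : weyl_module K n).
Implicit Types (X : {ffun 'I_n -> {mpoly K[n]}}) (g : {mpoly K[n]}).

Local Notation Mul g := (coefwise (poly_act g)).
Local Notation Der l := (coefwise (wd P l)).
Local Notation form r := (Ext n P r).

Definition interior r X (f : form r.+1) : form r :=
  \sum_i Mul (X i) (contract r i f).

Lemma Mul_Mul r g h (f : form r) : Mul g (Mul h f) = Mul (g * h) f.
Proof. by apply/ffunP => S; rewrite !ffunE poly_actM. Qed.

Lemma Mul1 r (f : form r) : Mul 1 f = f.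
Proof. by apply/ffunP => S; rewrite ffunE poly_act1. Qed.

Lemma MulD r g h (f : form r) : Mul (g + h) f = Mul g f + Mul h f.
Proof. by apply/ffunP => S; rewrite !ffunE poly_actD. Qed.

Lemma MulZ r a g (f : form r) : Mul (a *: g) f = a *: Mul g f.
Proof. by apply/ffunP => S; rewrite !ffunE poly_actZ. Qed.

Lemma Mul0 r (f : form r) : Mul 0 f = 0.
Proof. by apply/ffunP => S; rewrite !ffunE poly_act0. Qed.

Lemma Der_Mul r l g (f : form r) : Der l (Mul g f) = Mul (mderiv l g) f + Mul g (Der l f).
Proof. by apply/ffunP => S; rewrite !ffunE wd_poly_act. Qed.

Lemma DerC r l k (f : form r) : Der l (Der k f) = Der k (Der l f).
Proof. by apply/ffunP => S; rewrite !ffunE wdC. Qed.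

Lemma Der_SL_map r l (f : form r) : SL_map (Der l f) = Der l (SL_map f).
Proof.
rewrite linear_sum; apply: eq_bigr => k _ /=.
by rewrite wedge_coefwise DerC.
Qed.

Lemma SL_map_Mul r g (f : form r) :
  SL_map (Mul g f) = Mul g (SL_map f) + \sum_l Mul (mderiv l g) (wedge r.+1 l f).
Proof.
rewrite linear_sum -big_split; apply: eq_bigr => l _ /=.
by rewrite wedge_coefwise Der_Mul addrC.
Qed.

Lemma SL_map_var r i (f : form r) :
  SL_map (Mul 'X_i f) = Mul 'X_i (SL_map f) + wedge r.+1 i f.
Proof.
rewrite SL_map_Mul; congr (_ + _).
rewrite (bigD1 i) //= mderiv_var eqxx Mul1 big1 ?addr0 // => s /negPf si.
by rewrite mderiv_var si Mul0.
Qed.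

(** The [d_l] commute while the wedges by [e_l] anticommute, so the double sum is alternating. *)
Lemma SL_mapK r (f : form r) : SL_map (SL_map f) = 0.
Proof.
transitivity (\sum_l \sum_s Der l (Der s (wedge r.+2 l (wedge r.+1 s f)))).
  apply: eq_bigr => l _; rewrite !linear_sum; apply: eq_bigr => s _ /=.
  by rewrite wedge_coefwise.
apply: sum_alternating => [l s|l]; first by rewrite wedge_anti DerC !linearN.
rewrite (_ : wedge _ l _ = 0) ?linear0 //.
apply: ecoefP => S; rewrite ecoef0 !ecoef_wedge !inE eqxx /= scaler0.
by rewrite if_same.
Qed.

(** By Leibniz, [d i_X f] is the Jacobian part of the action plus the terms [X_i d_l E_(li) f];
    [i_X d f] is the derivative of the coefficients along [X] minus the same terms. *)
Lemma SL_act_Cartan r X (f : form r.+1) :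
  SL_act X f = SL_map (interior X f) + interior X (SL_map f).
Proof.
have -> : SL_map (interior X f) = \sum_l \sum_i Mul (mderiv l (X i)) (mx_unit l i f)
    + \sum_l \sum_i Mul (X i) (Der l (mx_unit l i f)).
  rewrite /SL_map -big_split; apply: eq_bigr => l _ /=.
  rewrite !linear_sum -big_split; apply: eq_bigr => i _ /=.
  by rewrite wedge_coefwise Der_Mul.
have -> : interior X (SL_map f) = coefwise (vf_act X) f
    - \sum_l \sum_i Mul (X i) (Der l (mx_unit l i f)).
  rewrite exchange_big -(coefwise_sum _ (fun i v => poly_act (X i) (wd P i v))).
  rewrite -sumrB; apply: eq_bigr => i _.
  rewrite !linear_sum /=.
  under eq_bigr => l _.
    rewrite contract_coefwise contract_wedge !linearB !linearZ eq_sym /=.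
    over.
  rewrite big_split /= sum_delta; congr (_ + _).
  by apply/ffunP => S; rewrite !ffunE.
by rewrite addrACA subrr addr0 addrC.
Qed.

(** [e_l /\ i_l f] keeps the components of [f] whose index set contains [l], and each index set has
    [r + 1] elements. In characteristic 0 this recovers [f] from its contractions. *)
Lemma wedge_contract_sum r (f : form r.+1) :
  \sum_l wedge r.+1 l (contract r l f) = r.+1%:R *: f.
Proof.
apply/ffunP => S; rewrite sum_ffunE [RHS]ffunE -!(ecoefE _ S).
transitivity (\sum_(l | l \in val S) ecoef f (val S)); last first.
  by rewrite sumr_const (eqP (valP S)) scaler_nat.
rewrite [RHS]big_mkcond; apply: eq_bigr => l _ /=.
rewrite -ecoefE ecoef_wedge; case: ifP => // lS.
rewrite ecoef_contract setD11 setD1K // ksignD // ltnn expr0 mul1r.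
by rewrite scalerA ksignK scale1r.
Qed.

Lemma contractK r i (f : form r.+2) : contract r i (contract r.+1 i f) = 0.
Proof.
apply: ecoefP => S; rewrite ecoef0 !ecoef_contract !inE eqxx /=.
by rewrite scaler0 if_same.
Qed.

Lemma SL_act_shear r j q (f : form r) :
  SL_act [ffun k => (k == j)%:R *: q] f =
    Mul q (Der j f) + \sum_s Mul (mderiv s q) (mx_unit s j f).
Proof.
rewrite /SL_act; congr (_ + _).
  by apply/ffunP => S; rewrite !ffunE vf_act_shear.
apply: eq_bigr => s _.
under eq_bigr => i _ do rewrite ffunE mderivZ MulZ.
exact: sum_delta.
Qed.

Lemma SL_act_const r j (f : form r) :
  SL_act [ffun k => (k == j)%:R *: 1] f = Der j f.
Proof.
rewrite SL_act_shear Mul1 big1 ?addr0 // => s _.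
by rewrite mderiv1 Mul0.
Qed.

Lemma SL_act_var r i j (f : form r) :
  SL_act [ffun k => (k == j)%:R *: 'X_i] f = Mul 'X_i (Der j f) + mx_unit i j f.
Proof.
rewrite SL_act_shear; congr (_ + _).
rewrite (bigD1 i) //= mderiv_var eqxx Mul1 big1 ?addr0 // => s /negPf si.
by rewrite mderiv_var si Mul0.
Qed.

Lemma interior_shear r j q (f : form r.+1) :
  interior [ffun k => (k == j)%:R *: q] f = Mul q (contract r j f).
Proof.
rewrite /interior; under eq_bigr => i _ do rewrite ffunE MulZ.
exact: sum_delta.
Qed.

Lemma MulB r g h (f : form r) : Mul (g - h) f = Mul g f - Mul h f.
Proof. by apply/ffunP => S; rewrite !ffunE poly_actB. Qed.

Lemma interior_ham r i j g (f : form r.+1) :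
  interior (ham i j g) f =
    Mul (mderiv i g) (contract r j f) - Mul (mderiv j g) (contract r i f).
Proof.
rewrite /interior /=; under eq_bigr => k _ do rewrite ffunE MulB !MulZ.
by rewrite sumrB !sum_delta.
Qed.

Section ClosedForms.
Variable N : submodule (SL_module P 2).
Hypothesis N_closed : forall w, N w -> SL_map w = 0.

Lemma N_sub (u v : form 2) : N u -> N v -> N (u - v).
Proof. by move=> Nu Nv; rewrite addrC -scaleN1r; exact: smD. Qed.

Lemma N_interior (X : Sn K n) (w : form 2) : N w -> N (SL_map (interior X w)).
Proof.
move=> Nw; have := sm_act X Nw; rewrite /= SL_act_Cartan (N_closed Nw).
by rewrite [interior X 0]big1 ?addr0 // => i _; rewrite !linear0.
Qed.

(* This is d_j X_(t_i g) w - (t_i d_j) X_g w, computed with Cartan's formula. *)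
Lemma N_contract2 i j g (w : form 2) : i != j -> N w ->
  N (SL_map (wedge 1 i (Mul (mderiv j g) (contract 0 j (contract 1 i w)))
             + contract 1 j (SL_map (Mul g (contract 1 j w))))).
Proof.
move=> ij Nw; pose a := interior (ham i j g) w.
have Nd := N_interior (shear (mderiv1 K j)) (N_interior (ham i j ('X_i * g)) Nw).
have Nt := N_interior (shear (mderiv_var_neq K ij)) (N_interior (ham i j g) Nw).
move: (N_sub Nd Nt); rewrite -linearB /= !interior_shear Mul1 -/a.
have -> : interior (ham i j ('X_i * g)) w = Mul 'X_i a + Mul g (contract 1 j w).
  rewrite /a !interior_ham !mderivM mderiv_var eqxx mul1r (mderiv_var_neq K ij) mul0r add0r.
  by rewrite MulD -!Mul_Mul -addrA -linearB addrC.
rewrite [X in contract 1 j X]linearD /= SL_map_var -addrA.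
rewrite [contract 1 j (_ + _)]linearD /= contract_coefwise [X in SL_map X]addrC addKr.
rewrite [contract 1 j (_ + _)]linearD /=.
(* There remains [i_j (e_i /\ a) = - e_i /\ i_j a], and as [i_j i_j = 0], [i_j a] reduces to
   [- (d_j g) i_j i_i w]. *)
rewrite contract_wedge eq_sym (negPf ij) scale0r sub0r.
rewrite {}/a interior_ham linearB /= !contract_coefwise contractK linear0 sub0r.
by rewrite linearN /= opprK.
Qed.

(** Quantifying over all [g] makes these forms stable under polynomials and, by [D_stable_Der],
    under all of [D_n]. *)
Definition D_stable (th : form 1) := forall g, N (SL_map (Mul g th)).

(** The term [i_j d(h i_j w)] in [N_contract2] is the same for [i] and [k] and cancels. The
    remaining coefficient [d_j h] is arbitrary, [d_j] being surjective on polynomials. *)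
Lemma D_stable_contract2 i j k (w : form 2) :
    [pchar K] =i pred0 -> i != j -> k != j -> N w ->
  D_stable (wedge 1 i (contract 0 j (contract 1 i w))
            - wedge 1 k (contract 0 j (contract 1 k w))).
Proof.
move=> K0 ij kj Nw g; have [h <-] := mderiv_surj K0 j g.
have := N_sub (N_contract2 h ij Nw) (N_contract2 h kj Nw).
rewrite -linearB /= opprD addrACA subrr addr0.
by rewrite !wedge_coefwise -linearB.
Qed.

Lemma D_stable_Mul h th : D_stable th -> D_stable (Mul h th).
Proof. by move=> th_st g; rewrite Mul_Mul. Qed.

Lemma D_stable_lin a th1 th2 : D_stable th1 -> D_stable th2 -> D_stable (a *: th1 + th2).
Proof. by move=> st1 st2 g; rewrite !linearP; exact: smD (st1 g) (st2 g). Qed.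

Lemma D_stable0 : D_stable 0.
Proof. by move=> g; rewrite !linear0; exact: sm0. Qed.

Lemma D_stable_Der k th : D_stable th -> D_stable (Der k th).
Proof.
move=> th_st g.
have -> : Mul g (Der k th) = Der k (Mul g th) - Mul (mderiv k g) th.
  by rewrite Der_Mul addrC addKr.
rewrite linearB /= Der_SL_map; apply: N_sub => //.
by have := sm_act (shear (mderiv1 K k)) (th_st g); rewrite /= SL_act_const.
Qed.

(** The field [t_s d_j] acts on forms as [t_s d_j] on coefficients plus [E_(sj)]. The full action
    commutes with [d] and preserves [N]; the coefficient part is covered by [D_stable_Der]. *)
Lemma D_stable_mx_unit s j th : s != j -> D_stable th -> D_stable (mx_unit s j th).
Proof.
move=> sj th_st g; pose X := shear (mderiv_var_neq K sj).
have -> : Mul g (mx_unit s j th) = SL_act X (Mul g th) - Mul 'X_s (Der j (Mul g th)).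
  by rewrite /= SL_act_var addrC addKr mx_unit_coefwise.
set u := SL_act X _; rewrite linearB /= {}/u SL_map_act.
apply: N_sub; first exact: (sm_act X (th_st g)).
rewrite -[Mul 'X_s _]Mul1; apply: D_stable_Mul; rewrite Der_Mul.
rewrite -[Mul (mderiv j g) th]scale1r; apply: D_stable_lin; apply: D_stable_Mul => //.
exact: D_stable_Der.
Qed.

(** For [r <> s], [E_(rs)] maps [th] to [p e_r], with [p] the coefficient of [e_s]. The [q] with
    [q e_r] stable thus form a nonzero [D_n]-submodule, hence [P]; one more matrix unit reaches
    [e_s]. *)
Lemma D_stable_all s th : D_simple P -> (2 <= n)%N -> D_stable th ->
  contract 0 s th <> 0 -> forall th', D_stable th'.
Proof.
move=> [_ P_simple] n2 th_st c0.
pose cst (p : P) : form 0 := [ffun=> p].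
have cstE (f : form 0) : exists p, f = cst p.
  have S0 : rset n 0 by exists set0; rewrite cards0.
  exists (f S0); apply/ffunP => S; rewrite ffunE; congr (f _).
  by apply: val_inj; rewrite !rset0.
have [p pE] := cstE (contract 0 s th).
have all_other r q : r != s -> D_stable (wedge 1 r (cst q)).
  move=> rs; have [|only0|//] := P_simple (fun q => D_stable (wedge 1 r (cst q))).
  - have cst_lin a u v : cst (a *: u + v) = a *: cst u + cst v.
      by apply/ffunP => S; rewrite !ffunE.
    have cst0 : cst 0 = 0 by apply/ffunP => S; rewrite !ffunE.
    split=> [|a u v su sv|i v sv|i v sv].
    + by rewrite cst0 linear0; exact: D_stable0.
    + by rewrite cst_lin linearP; exact: D_stable_lin.
    + rewrite -poly_actX (_ : cst _ = Mul 'X_i (cst v)); last first.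
        by apply/ffunP => S; rewrite !ffunE.
      by rewrite wedge_coefwise; exact: D_stable_Mul.
    + rewrite (_ : cst _ = Der i (cst v)); last by apply/ffunP => S; rewrite !ffunE.
      by rewrite wedge_coefwise; exact: D_stable_Der.
  case: c0; rewrite pE (only0 p); first by apply/ffunP => S; rewrite !ffunE.
  by rewrite -pE; exact: D_stable_mx_unit.
have all_dx r q : D_stable (wedge 1 r (cst q)).
  have [->|rs] := eqVneq r s; last exact: all_other.
  have [t ts] := exists_neq s n2.
  have := D_stable_mx_unit _ (all_other t q ts); move=> /(_ s t).
  rewrite mx_unit_wedge eqxx scale1r mx_unit0 linear0 addr0; apply.
  by rewrite eq_sym.
move=> th'; rewrite -[th']scale1r -(wedge_contract_sum th').
elim: (index_enum _) => [|r l IH]; first by rewrite big_nil; exact: D_stable0.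
rewrite big_cons -[wedge _ _ _]scale1r; apply: D_stable_lin => //.
by have [q ->] := cstE (contract 0 r th').
Qed.

End ClosedForms.

Lemma SL_map_simple (N : submodule (SL_module P 2)) :
    [pchar K] =i pred0 -> D_simple P -> (3 <= n)%N ->
    (forall w, N w -> SL_map w = 0) ->
  (forall w, N w -> w = 0) \/ (forall th, N (SL_map th)).
Proof.
move=> K0 Ps n3 N_closed.
have [[w [Nw w0]]|allN] := pselect (exists w, N w /\ w <> 0); [right | left]; last first.
  by move=> w Nw; apply: contrapT => w0; apply: allN; exists w.
(* Applying [wedge_contract_sum] twice rebuilds [w] from its double contractions, so one of these is
   nonzero. *)
have [i [j c0]] : exists i j, contract 0 j (contract 1 i w) <> 0.
  apply: contrapT => c0; apply: w0; have := wedge_contract_sum w.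
  rewrite big1 => [/esym/eqP|i _]; first by rewrite scaler_eq0 (negPf (natS_neq0 K0 _)) => /eqP.
  have := wedge_contract_sum (contract 1 i w).
  rewrite scale1r big1 => [<-|j _]; first by rewrite linear0.
  rewrite (_ : contract _ j _ = 0) ?linear0 //.
  by apply: contrapT => cj; apply: c0; exists i, j.
have ij : i != j by apply/eqP => ij; apply: c0; rewrite ij contractK.
have [k] : exists k, k \notin [set i; j].
  apply/existsP; apply: contraTT n3; rewrite negb_exists -ltnNge => /forallP all_ij.
  have : (n <= #|[set i; j]|)%N.
    rewrite -[X in (X <= _)%N]card_ord; apply: subset_leq_card.
    by apply/subsetP => k _; apply/negPn/all_ij.
  by rewrite cards2 ij.
rewrite !inE negb_or => /andP[ki kj].
have th_st := D_stable_contract2 N_closed K0 ij kj Nw.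
have st := D_stable_all Ps (ltnW n3) th_st.
(* Contracting the stable form with index [i] leaves [i_j i_i w <> 0], because [k <> i]. *)
move=> th; rewrite -[th]Mul1; apply: (st i); rewrite linearB /= !contract_wedge eqxx.
rewrite eq_sym (negPf ki) scale1r scale0r !wedge_to0 !subr0.
exact: c0.
Qed.

End DeRham.

(** * The filtration of F(P, V(delta_1)) *)

Section Filtration.
Local Open Scope ring_scope.
Variables (K : fieldType) (n : nat) (P : weyl_module K n).
Implicit Types W T : Sn_module K n.

Lemma SL0_subquo W : subquo (SL_module P 0) W <-> subquo (nat_module P) W.
Proof.
have iso := SL_module0 P.
split; [have [h [hb hP]] := iso | have [h [hb hP]] := Sn_iso_sym iso];
  exact: (subquo_inj hP (bij_inj hb)).
Qed.

(** The exact 1-forms are a quotient of [P], and [d] maps the 1-forms modulo exact ones onto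
    [Ln P 2]. The kernel of this map is cohomology, on which Cartan's formula makes the action
    trivial. *)
Lemma SL1_subquo W : irreducible W -> ~ trivial_module W ->
  subquo (SL_module P 1) W -> subquo (nat_module P) W \/ subquo (Ln P 2) W.
Proof.
move=> W_irr Wt; pose I := hom_image (@SL_pi_hom K n P 0).
case/(subquo_split I W_irr) => [sqI|sqQ].
  left; apply/SL0_subquo; have [j [jP jsurj _]] := corestrict (@SL_pi_hom K n P 0).
  exact: subquo_surj jP jsurj sqI.
right; have [g [gP gsurj gE]] := corestrict (@SL_pi_hom K n P 1).
have [v /qmap_eq0[u <-]|h hP hq] := factor_hom (@qmap_hom _ _ _ I) gP (@qmap_surj _ _ _ I).
  by apply: incl_inj; rewrite gE linear0; exact: SL_mapK.
have [sqk|//] := subquo_split_hom hP W_irr sqQ.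
case: Wt; apply: subquo_trivial sqk => X x; apply: incl_inj; rewrite linear0.
have [v vx] := qmap_surj (incl _ x).
have dv : SL_map v = 0.
  have /sm_boolP hx := sub_valP x.
  have := gE v; rewrite -hq vx [h _]hx linear0 => /esym. exact.
have -> : incl _ (Sn_act X x) = qmap I (Sn_act X v) by rewrite qmap_hom vx.
apply/qmap_eq0.
exists (interior X v); rewrite /= SL_act_Cartan dv [interior X 0]big1 ?addr0 // => i _.
by rewrite !linear0.
Qed.

(** The [i]-th contraction of [d f] is [d_i f], and [d_i] is the action of a field in [S_n], so [h]
    commutes with it. *)
Lemma SL_map0_eq0 (h : {linear SL_module P 0 -> nat_module P}) f :
  Sn_hom h -> SL_map f = 0 -> forall i, wd P i (h f) = 0.
Proof.
move=> hP df0 i; have := hP (shear (mderiv1 K i)) f.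
rewrite /= vf_act_shear poly_act1 SL_act_const => <-.
suff -> : coefwise (wd P i) f = 0 by rewrite linear0.
have : contract 0 i (SL_map f) = 0 by rewrite df0 linear0.
rewrite linear_sum (bigD1 i) //= big1 => [|k /negPf ki].
  by rewrite addr0 contract_coefwise contract_wedge eqxx scale1r wedge_to0 subr0.
by rewrite contract_coefwise contract_wedge eq_sym ki scale0r wedge_to0 subr0 linear0.
Qed.

(** [T] is a quotient of the exact 1-forms, since [g] vanishes on the kernel of [d] on 0-forms. *)
Lemma SL1_subquo_image T (g : {linear nat_module P -> T}) :
  Sn_hom g -> surj g -> (forall p : P, (forall i, wd P i p = 0) -> g p = 0) ->
  subquo (SL_module P 1) T.
Proof.
move=> gP g_surj kerg; have [h [[h' hK h'K] hP]] := SL_module0 P.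
apply: (subquo_image (@SL_pi_hom K n P 0) (g := g \o h)) => [X f|y|f f0].
- by rewrite /= hP gP.
- by have [p <-] := g_surj y; exists (h' p); rewrite /= h'K.
- exact/kerg/(SL_map0_eq0 hP).
Qed.

Lemma subquo_Ln : subquo (SL_module P 1) (Ln P 2).
Proof.
have [g [gP gsurj gE]] := corestrict (@SL_pi_hom K n P 1).
by exists (SL_module P 1), idfun, g; split.
Qed.

Lemma nat_nontrivial : (exists p : P, p <> 0) -> (0 < n)%N -> ~ trivial_module (nat_module P).
Proof.
move=> [p p0] n0 Pt; pose i := Ordinal n0; apply: p0.
have wd0 (q : P) : wd P i q = 0.
  by have := Pt (shear (mderiv1 K i)) q; rewrite /= vf_act_shear poly_act1.
by have := wd_wt i p; rewrite !wd0 linear0 add0r => <-.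
Qed.

(** A trivial action gives [d (d_i th) = 0] for all [th]. Taking [th = q e_j] yields
    [d_i d_i q = 0]; replacing [q] by [t_i q] yields [2 d_i q = 0], against [[d_i, t_i] = 1]. *)
Lemma Ln_nontrivial : [pchar K] =i pred0 -> (exists p : P, p <> 0) -> (2 <= n)%N ->
  ~ trivial_module (Ln P 2).
Proof.
move=> K0 [p p0] n2 Lt; pose i := Ordinal (ltnW n2); have [j ji] := exists_neq i n2.
have [g [gP gsurj gE]] := corestrict (@SL_pi_hom K n P 1).
have dDer (th : SL_module P 1) : SL_map (coefwise (wd P i) th) = 0.
  have := gE (Sn_act (shear (mderiv1 K i)) th).
  by rewrite gP Lt linear0 /= SL_act_const => <-.
have ddf (f : Ext n P 0) : coefwise (wd P i) (coefwise (wd P i) f) = 0.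
  have := dDer (wedge 1 j f); rewrite -wedge_coefwise; set f' := coefwise _ f => df'.
  have CW : contract 0 i (wedge 1 j f') = 0.
    by rewrite contract_wedge eq_sym (negPf ji) scale0r wedge_to0 subr0.
  have E : contract 1 i (SL_map (wedge 1 j f')) = coefwise (wd P i) (wedge 1 j f').
    rewrite linear_sum (bigD1 i) //= big1 => [|k /negPf ki].
      by rewrite addr0 contract_coefwise contract_wedge eqxx scale1r CW linear0 subr0.
    by rewrite contract_coefwise contract_wedge eq_sym ki scale0r sub0r CW !linear0.
  have := congr1 (contract 0 j) E.
  rewrite df' !linear0 contract_coefwise contract_wedge eqxx scale1r wedge_to0 subr0.
  by move=> <-.
have dd (q : P) : wd P i (wd P i q) = 0.
  have S0 : rset n 0 by exists set0; rewrite cards0.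
  by have /ffunP/(_ S0) := ddf [ffun=> q]; rewrite !ffunE.
have d0 (q : P) : wd P i q = 0.
  have := dd (wt P i q); rewrite wd_wt linearD wd_wt dd linear0 add0r.
  rewrite -mulr2n -scaler_nat => /eqP.
  by rewrite scaler_eq0 (negPf (natS_neq0 K0 1)) => /eqP.
by apply: p0; have := wd_wt i p; rewrite !d0 linear0 add0r => <-.
Qed.

Lemma Ln_irreducible : [pchar K] =i pred0 -> D_simple P -> (3 <= n)%N ->
  irreducible (Ln P 2).
Proof.
move=> K0 Ps n3; apply: irreducibleI => [|N].
  exact: (Ln_nontrivial K0 (proj1 Ps) (ltnW n3)).
have [g [gP gsurj gE]] := corestrict (@SL_pi_hom K n P 1).
pose L := hom_image (@SL_pi_hom K n P 1).
have iP : Sn_hom (incl L \o incl N) by [].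
have [_ [x <-]|N0|NT] := SL_map_simple (N := hom_image iP) K0 Ps n3.
- have [v vx] := gsurj (incl N x).
  suff : SL_map (incl L (g v) : Ext n P 2) = 0 by rewrite vx.
  by rewrite gE; exact: SL_mapK.
- left=> v Nv; have vN : v \in sm_bool N by apply/sm_boolP.
  by apply: incl_inj; rewrite linear0; apply: N0; exists (SubVect vN).
right=> v; have [th <-] := gsurj v; have [x xE] := NT th.
have <- : incl N x = g th by apply: (@incl_inj _ _ _ L); exact: etrans xE (esym (gE th)).
by have /sm_boolP := sub_valP x.
Qed.

Lemma Delta_min (N : submodule (nat_module P)) : (2 <= n)%N -> D_simple P ->
  (forall v, N v -> forall i, wd P i v = 0) \/ (forall v, Delta P v -> N v).
Proof.
move=> n2 Ps.
have [[v [i [Nv dv]]]|allN] := pselect (exists v i, N v /\ wd P i v <> 0); [right | left].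
  exact: Delta_sub Ps Nv dv.
by move=> v Nv i; apply: contrapT => dv; apply: allN; exists v, i.
Qed.

(** Divergence zero turns [X v] into [\sum_i d_i (X_i v)]. *)
Lemma quot_Delta_trivial : trivial_module (quotmod (Delta P)).
Proof.
move=> X x; have [v <-] := qmap_surj x; rewrite -qmap_hom; apply/qmap_eq0.
exists (fun i => poly_act (X i) v).
under [RHS]eq_bigr => i _ do rewrite wd_poly_act.
by rewrite big_split /= -poly_act_sum Sn_div poly_act0 add0r.
Qed.

Lemma Delta_irreducible : [pchar K] =i pred0 -> (2 <= n)%N -> D_simple P ->
  (forall v : P, (forall i, wd P i v = 0) -> v = 0) ->
  irreducible (submod (Delta P)) /\ ~ trivial_module (submod (Delta P)).
Proof.
move=> K0 n2 Ps dinj.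
have Delta_wd i (p : P) : wd P i p \in sm_bool (Delta P).
  apply/sm_boolP; exists (fun k => (k == i)%:R *: p).
  by under eq_bigr => k _ do rewrite linearZ /=; rewrite sum_delta.
have nt : ~ trivial_module (submod (Delta P)).
  move=> Dt; have [p p0] := proj1 Ps; apply: p0.
  (* A trivial action gives [d_j d_i p = 0] for all [i] and [j], and injectivity applied twice gives
     [p = 0]. *)
  apply: (dinj) => i; apply: (dinj) => j.
  have := congr1 (incl _) (Dt (shear (mderiv1 K j)) (SubVect (Delta_wd i p))).
  by rewrite linear0 /= vf_act_shear poly_act1.
split=> //; apply: irreducibleI => // N.
have iP : Sn_hom (incl (Delta P) \o incl N) by [].
have [N0|NT] := Delta_min (hom_image iP) n2 Ps; [left | right] => v.
  move=> Nv; have vN : v \in sm_bool N by apply/sm_boolP.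
  by apply: incl_inj; rewrite linear0; apply: dinj; apply: N0; exists (SubVect vN).
have /sm_boolP/NT[x /incl_inj <-] := sub_valP v.
by have /sm_boolP := sub_valP x.
Qed.

End Filtration.

(** * The three kinds of [P], and the classification for [n >= 3] *)

Section Cases.
Local Open Scope ring_scope.
Variables (K : fieldType) (n : nat).
Hypotheses (K_char0 : [pchar K] =i pred0) (n2 : (2 <= n)%N).
Local Notation A := (An K n).
Local Notation F := (twistF A).

(** [Delta_min] is applied to preimages in [An]: vectors killed by all [d_i] are constants, and
    [Delta An] is all of [An] because [d_i] is surjective. *)
Lemma quot_constants_irreducible :
  irreducible (quotmod (constants K n)) /\ ~ trivial_module (quotmod (constants K n)).
Proof.
pose C := constants K n; pose i := Ordinal (ltnW n2).
have nt : ~ trivial_module (quotmod C).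
  move=> Ct; have [q qE] := mderiv_surj K_char0 i ('X_i : {mpoly K[n]}).
  have := Ct (shear (mderiv1 K i)) (qmap C q).
  rewrite -qmap_hom => /qmap_eq0; rewrite /= vf_act_shear poly_act1 /= qE.
  case=> c /(congr1 (mderiv i)); rewrite mderivZ mderiv1 mderiv_var eqxx scaler0.
  by move/eqP; rewrite oner_eq0.
split=> //; apply: irreducibleI => // N.
have [N0|NT] := Delta_min (hom_preim (@qmap_hom _ _ _ C) N) n2 (An_D_simple n K_char0).
  left=> x; have [v <-] := qmap_surj x => /(N0 v) dv; apply/qmap_eq0.
  by exists v@_0%MM; apply: mderiv_eq0.
right=> x; have [v <-] := qmap_surj x; apply: (NT v).
have [q <-] := mderiv_surj K_char0 i v.
exists (fun k => (k == i)%:R *: q).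
by under eq_bigr => k _ do rewrite linearZ /=; rewrite sum_delta.
Qed.

Lemma constants_trivial : trivial_module (submod (constants K n)).
Proof.
move=> X v; apply: incl_inj; have /sm_boolP[c vE] := sub_valP v.
rewrite linear0 -[LHS]/(vf_act X (sub_val v)) vE; apply: big1 => i _ /=.
by rewrite mderivZ mderiv1 scaler0 linear0.
Qed.

Lemma twistF_wd_inj (v : F) : (forall i, wd F i v = 0) -> v = 0.
Proof.
move=> /(_ (Ordinal (ltnW n2))) /eqP; rewrite /= /opp_t oppr_eq0 mulf_eq0.
by rewrite -msupp_eq0 msuppX => /eqP.
Qed.

(** The alternatives of [Delta_min] become zero and everything: only 0 is killed by all [d_i], as
    [P] is not [An], and [Delta P] is [P], as [P] is not [twistF An]. *)
Lemma SL0_irreducible (P : weyl_module K n) :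
  D_simple P -> D_weight P -> ~ D_iso P A -> ~ D_iso P F ->
  irreducible (SL_module P 0) /\ ~ trivial_module (SL_module P 0).
Proof.
move=> Ps Pw PA PF; have iso := SL_module0 P.
have nt : ~ trivial_module (nat_module P) by exact: (nat_nontrivial (proj1 Ps) (ltnW n2)).
split; last by move=> Pt; apply: nt; apply: trivial_iso Pt; exact: Sn_iso_sym.
apply: irreducible_iso iso _; apply: irreducibleI => // N.
have [N0|NT] := Delta_min N n2 Ps; [left | right] => v.
  by move=> Nv; apply: (wd_inj K_char0 Ps PA) => i; apply: N0.
by apply/NT/(Delta_full K_char0 Ps Pw PF).
Qed.

(** What each case must supply: the factor [T] coming from the 0-forms. The last clause concerns [P]
    itself, so that it also applies to the 2-forms when [n = 2]. *)
Definition SL1_target (P : weyl_module K n) (T : Sn_module K n) :=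
  [/\ irreducible T, ~ trivial_module T, subquo (SL_module P 1) T
    & forall W, irreducible W -> ~ trivial_module W -> subquo (nat_module P) W -> Sn_iso W T].

Lemma SL1_target_generic (P : weyl_module K n) :
  D_simple P -> D_weight P -> ~ D_iso P A -> ~ D_iso P F -> SL1_target P (SL_module P 0).
Proof.
move=> Ps Pw PA PF; have [irr nt] := SL0_irreducible Ps Pw PA PF.
have [g [gb gP]] := Sn_iso_sym (SL_module0 P).
split=> // [|W W_irr Wt /SL0_subquo]; last exact: subquo_irreducible.
apply: (SL1_subquo_image gP) => [y|p dp]; first by have [g' _ gK] := gb; exists (g' y).
by rewrite (wd_inj K_char0 Ps PA dp) linear0.
Qed.

(** The constants are both the kernel of [d] on 0-forms and a trivial submodule with irreducible
    quotient. *)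
Lemma SL1_target_An : SL1_target A (quotmod (constants K n)).
Proof.
have [irr nt] := quot_constants_irreducible.
split=> // [|W W_irr Wt /(subquo_split (constants K n) W_irr)[sq|]].
- apply: (SL1_subquo_image (@qmap_hom _ _ _ _) (@qmap_surj _ _ _ _)) => p dp.
  by apply/qmap_eq0; exists p@_0%MM; apply: mderiv_eq0.
- by case: Wt; apply: subquo_trivial sq; exact: constants_trivial.
exact: subquo_irreducible.
Qed.

(** Here [d_i] acts as [- t_i], so [d] embeds the 0-forms, and [Delta F] with them, in the 1-forms;
    [F / Delta F] is trivial. *)
Lemma SL1_target_twistF : SL1_target F (submod (Delta F)).
Proof.
have Fs : D_simple F := twistF_D_simple (An_D_simple n K_char0).
have [irr nt] := Delta_irreducible K_char0 n2 Fs twistF_wd_inj.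
split=> // [|W W_irr Wt /(subquo_split (Delta F) W_irr)[|sq]].
- have [h [hb hP]] := SL_module0 F.
  apply: (@subquo_inj _ _ (SL_module F 0) _ _ _ (@SL_pi_hom K n F 0)).
    move=> f1 f2 f12; apply: (bij_inj hb); apply/eqP; rewrite -subr_eq0 -linearB.
    apply/eqP/twistF_wd_inj/SL_map0_eq0 => //.
    by rewrite linearB; apply/eqP; rewrite subr_eq0; apply/eqP.
  by apply/SL0_subquo/subquo_sub.
- exact: subquo_irreducible.
by case: Wt; apply: subquo_trivial sq; exact: quot_Delta_trivial.
Qed.

Lemma SL1_subquotients_ge3 (P : weyl_module K n) T W :
  (3 <= n)%N -> D_simple P -> SL1_target P T ->
  nontrivial_irr_subquotient (SL_module P 1) W <-> Sn_iso W T \/ Sn_iso W (Ln P 2).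
Proof.
move=> n3 Ps [T_irr Tt sqT class]; have L_irr := Ln_irreducible K_char0 Ps n3.
split=> [[/subquotientP sqW W_irr Wt]|[WT|WL]].
- have [/(class W W_irr Wt)|sqL] := SL1_subquo W_irr Wt sqW; first by left.
  by right; exact: subquo_irreducible.
- exact: nontrivial_irr_subquotientI WT.
apply: nontrivial_irr_subquotientI WL => //; last exact: subquo_Ln.
exact: (Ln_nontrivial K_char0 (proj1 Ps) n2).
Qed.

End Cases.

(** * Dimension 2, where 2-forms are top forms *)

Section Dimension2.
Local Open Scope ring_scope.
Variable K : fieldType.

(** On top forms [E_(si)] is 1 for [s = i] and 0 otherwise, so the Jacobian part of the action is
    multiplication by the divergence, which is zero. *)
Lemma SL_module2 (P : weyl_module K 2) : Sn_iso (SL_module P 2) (nat_module P).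
Proof.
have cT : #|[set: 'I_2]| == 2 by rewrite cardsT card_ord.
pose top : rset 2 2 := exist _ setT cT.
have topE S : S = top.
  by apply: val_inj; apply/eqP; rewrite eqEcard subsetT /= cardsT card_ord (eqP (valP S)).
pose ev (f : Ext 2 P 2) : P := f top.
have ev_lin : linear ev by move=> a f g; rewrite /ev !ffunE.
pose evL : {linear SL_module P 2 -> nat_module P} :=
  HB.pack (ev : SL_module P 2 -> nat_module P) (GRing.isLinear.Build _ _ _ _ ev ev_lin).
exists evL; split.
  exists (fun v => [ffun=> v] : Ext 2 P 2) => [f|v]; last by rewrite /= /ev ffunE.
  by apply/ffunP => S; rewrite ffunE (topE S).
move=> X f; rewrite /= /ev /SL_act !ffunE sum_ffunE.
rewrite (_ : \sum_s _ = 0) ?addr0 //.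
transitivity (\sum_s poly_act (mderiv s (X s)) (f top)).
  apply: eq_bigr => s _; rewrite sum_ffunE (bigD1 s) //= big1 => [|i is_].
    rewrite addr0 ffunE; congr poly_act; rewrite -!ecoefE ecoef_wedge inE.
    rewrite ecoef_contract setD11 setD1K ?inE // ksignD ?inE // ltnn expr0 mul1r.
    by rewrite scalerA ksignK scale1r.
  rewrite ffunE -ecoefE ecoef_wedge inE ecoef_contract !inE is_ /=.
  by rewrite scaler0 linear0.
by rewrite -poly_act_sum Sn_div poly_act0.
Qed.

(** [Ln P 2] lies in the 2-forms, a copy of [P], so its subquotients are again subquotients of
    [P]. *)
Lemma SL1_subquotients_2 (P : weyl_module K 2) T W : SL1_target P T ->
  nontrivial_irr_subquotient (SL_module P 1) W <-> Sn_iso W T.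
Proof.
move=> [T_irr Tt sqT class]; split=> [[/subquotientP sqW W_irr Wt]|WT]; last first.
  exact: nontrivial_irr_subquotientI WT.
apply: class => //; have [//|sqL] := SL1_subquo W_irr Wt sqW.
have [h [hb hP]] := SL_module2 P; apply: (subquo_inj hP (bij_inj hb)).
exact: (subquo_inj (@incl_hom _ _ _ _) (@incl_inj _ _ _ _) sqL).
Qed.

End Dimension2.

Theorem proposition4p2 (R : realType) (n : nat) (hn : (2 <= n)%N)
    (P : weyl_module R[i] n) (P_simple : D_simple P) (P_weight : D_weight P) :
  (* (a) *)
  ((3 <= n)%N -> ~ D_iso P (An R[i] n) -> ~ D_iso P (twistF (An R[i] n)) ->
    forall W : Sn_module R[i] n,
      nontrivial_irr_subquotient (SL_module P 1) W <->
      Sn_iso W (SL_module P 0) \/ Sn_iso W (Ln P 2))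
  /\
  (* (b) *)
  ((3 <= n)%N ->
    forall W : Sn_module R[i] n,
      nontrivial_irr_subquotient (SL_module (An R[i] n) 1) W <->
      Sn_iso W (quotmod (constants R[i] n)) \/ Sn_iso W (Ln (An R[i] n) 2))
  /\
  (* (c) *)
  ((3 <= n)%N ->
    forall W : Sn_module R[i] n,
      nontrivial_irr_subquotient (SL_module (twistF (An R[i] n)) 1) W <->
      Sn_iso W (submod (Delta (twistF (An R[i] n)))) \/
      Sn_iso W (Ln (twistF (An R[i] n)) 2))
  /\
  (* (d) *)
  (n = 2%N -> ~ D_iso P (An R[i] n) -> ~ D_iso P (twistF (An R[i] n)) ->
    forall W : Sn_module R[i] n,
      nontrivial_irr_subquotient (SL_module P 1) W <->
      Sn_iso W (SL_module P 0))
  /\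
  (* (e) *)
  (n = 2%N ->
    forall W : Sn_module R[i] n,
      nontrivial_irr_subquotient (SL_module (An R[i] n) 1) W <->
      Sn_iso W (quotmod (constants R[i] n)))
  /\
  (* (f) *)
  (n = 2%N ->
    forall W : Sn_module R[i] n,
      nontrivial_irr_subquotient (SL_module (twistF (An R[i] n)) 1) W <->
      Sn_iso W (submod (Delta (twistF (An R[i] n))))).
Proof.
have K0 : ([pchar R[i]] =i pred0)%R by exact: Num.Theory.pchar_num.
have As := An_D_simple n K0; have Fs := twistF_D_simple As.
split=> [n3 PA PF W|].
  apply: (SL1_subquotients_ge3 K0 hn W n3 P_simple).
  exact: (SL1_target_generic K0 hn P_simple P_weight PA PF).
split=> [n3 W|]; first exact: (SL1_subquotients_ge3 K0 hn W n3 As (SL1_target_An K0 hn)).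
split=> [n3 W|]; first exact: (SL1_subquotients_ge3 K0 hn W n3 Fs (SL1_target_twistF K0 hn)).
split=> [n2|]; first subst n.
  by move=> PA PF W; apply/SL1_subquotients_2/(SL1_target_generic K0 hn).
by split=> n2 W; subst n; apply: SL1_subquotients_2;
  [exact: SL1_target_An | exact: SL1_target_twistF].
Qed.
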